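(* Let $Z\subset\mathbb{S}_6$ be a finite nonempty set of points. Then $\alpha(Z)=\alpha(2Z)=\alpha(3Z)=1$ if and only if $Z=\{Q\}$ for a single point $Q$ satisfying one of: (a) $Q\in\widetilde{L_{ij}}\cap\widetilde{L_{kl}}\cap\widetilde{L_{mn}}$ for some pairwise distinct $i,j,k,l,m,n\in\{1,\dots,6\}$; (b) $Q\in E_i\cap\widetilde{L_{ij}}\cap\widetilde{C_j}$ for some distinct $i,j\in\{1,\dots,6\}$, where $C_j$ is the conic through the five points $\{P_1,\dots,P_6\}\setminus\{P_j\}$ and the line $L_{ij}$ is tangent to $C_j$ at $P_i$.
   Context: Let $P_1,\dots,P_6\in\mathbb{P}^2(\mathbb{C})$ be six general points and $f\colon\mathbb{S}_6\to\mathbb{P}^2$ the blow-up at them, with exceptional curves $E_i=f^{-1}(P_i)$; let $H$ be the pullback of the class of a line and $\mathbb{L}_6=3H-E_1-\dots-E_6=-K_{\mathbb{S}_6}$. For distinct $i,j$, $L_{ij}$ is the line through $P_i,P_j$; for a plane curve $C$, $\widetilde{C}$ denotes its proper transform in $\mathbb{S}_6$. For a finite set $Z\subset\mathbb{S}_6$ with ideal sheaf $\mathcal{I}_Z$ and a positive integer $m$, $\alpha(mZ)=\min\{d\ge 0:\ H^0(\mathbb{S}_6,d\mathbb{L}_6\otimes\mathcal{I}_Z^{(m)})\neq 0\}$, i.e. the least $d$ such that some effective divisor $D\in|d\mathbb{L}_6|$ has multiplicity at least $m$ at every point of $Z$. *)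

(* Defs.v *)
From mathcomp Require Import all_boot all_order all_algebra.
From mathcomp Require Import reals.
From mathcomp.real_closed Require Import complex.
From mathcomp Require Import mpoly.

Set Implicit Arguments.
Unset Strict Implicit.
Unset Printing Implicit Defensive.

Import GRing.Theory.
Local Open Scope ring_scope.

Section CubicSurface.
Variable R : rcfType.
Local Notation K := (R[i]).

(* Homogeneous coordinates of points of P^2(K): vectors of K^3. *)
Definition vec3 := 'I_3 -> K.

Definition nonzero3 (a : vec3) : Prop := exists k, a k != 0.

(* a and b represent the same projective point (when both are nonzero). *)
Definition proportional (a b : vec3) : Prop :=
  forall k l, a k * b l = a l * b k.

Definition det3 (a b c : vec3) : K :=
  \det (\matrix_(r < 3, s < 3)
          (if r == 0 :> nat then a s else if r == 1 :> nat then b s else c s)).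

Definition line_poly (a b : vec3) : {mpoly K[3]} :=
  \det (\matrix_(r < 3, s < 3)
          (if r == 0 :> nat then (a s)%:MP
           else if r == 1 :> nat then (b s)%:MP else 'X_s)).

(* all monomials of p have total degree >= k, i.e. p has multiplicity >= k
   at the origin *)
Definition mono_ge (n : nat) (p : {mpoly K[n]}) (k : nat) : Prop :=
  forall m, m \in msupp p -> (k <= mdeg m)%N.

(* affine chart of P^2 centered at q : (a,b) |-> q + a v1 + b v2 *)
Definition offchart (q v1 v2 : vec3) : 3.-tuple {mpoly K[2]} :=
  [tuple (q k)%:MP + (v1 k)%:MP * 'X_ord0 + (v2 k)%:MP * 'X_ord_max | k < 3].

(* chart of the blow-up of P^2 at p : (s,t) |-> p + s w + s t u;
   the exceptional curve is {s = 0}, and (0,0) is the point of the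
   exceptional curve corresponding to the tangent direction of the line p w *)
Definition excchart (p w u : vec3) : 3.-tuple {mpoly K[2]} :=
  [tuple (p k)%:MP + (w k)%:MP * 'X_ord0 + (u k)%:MP * 'X_ord0 * 'X_ord_max
  | k < 3].

Definition mult_plane_ge (F : {mpoly K[3]}) (q : vec3) (m : nat) : Prop :=
  forall v1 v2, det3 q v1 v2 != 0 -> mono_ge (F \mPo offchart q v1 v2) m.

(* Points of S_6 = Bl_{P_1..P_6} P^2:
   - [Off q] : the point of S_6 over q in P^2 \ {P_1,...,P_6};
   - [Exc i w] : the point of E_i corresponding to the tangent direction at
     P_i of the line through P_i and w. *)
Inductive spt := Off of vec3 | Exc of 'I_6 & vec3.

Section Config.
Variable P : 'I_6 -> vec3.

Definition valid_pt (z : spt) : Prop :=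
  match z with
  | Off q => nonzero3 q /\ forall i, ~ proportional q (P i)
  | Exc i w => nonzero3 w /\ ~ proportional w (P i)
  end.

Definition same_pt (z z' : spt) : Prop :=
  match z, z' with
  | Off q, Off q' => proportional q q'
  | Exc i w, Exc i' w' => i = i' /\ det3 (P i) w w' = 0
  | _, _ => False
  end.

Definition on_E (z : spt) (i : 'I_6) : Prop :=
  match z with Exc i' _ => i' = i | Off _ => False end.

(* F defines an effective divisor D = f^* V(F) - d (E_1+...+E_6) in |d L_6|:
   F is a nonzero form of degree 3d with multiplicity >= d at each P_i. *)
Definition in_linsys (d : nat) (F : {mpoly K[3]}) : Prop :=
  [/\ F != 0, F \is (3 * d)%N.-homog & forall i, mult_plane_ge F (P i) d].

(* the divisor D = f^* V(F) - d (E_1+...+E_6) has multiplicity >= m at z *)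
Definition mult_div_ge (d : nat) (F : {mpoly K[3]}) (z : spt) (m : nat) : Prop :=
  match z with
  | Off q => mult_plane_ge F q m
  | Exc i w => forall u, det3 (P i) w u != 0 ->
                 mono_ge (F \mPo excchart (P i) w u) (m + d)
  end.

(* H^0(S_6, d L_6 (x) I_Z^(m)) <> 0 *)
Definition has_div (n : nat) (Z : 'I_n -> spt) (m d : nat) : Prop :=
  exists F, in_linsys d F /\ forall k, mult_div_ge d F (Z k) m.

Definition alpha_is (n : nat) (Z : 'I_n -> spt) (m a : nat) : Prop :=
  has_div Z m a /\ forall d, (d < a)%N -> ~ has_div Z m d.

(* z lies on the proper transform of the plane curve V(F) (F nonzero form) *)
Definition on_proper (F : {mpoly K[3]}) (z : spt) : Prop :=
  match z with
  | Off q => F.@[q] = 0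
  | Exc i w => exists m, [/\ mult_plane_ge F (P i) m,
                 ~ mult_plane_ge F (P i) m.+1 &
                 forall u, det3 (P i) w u != 0 ->
                   mono_ge (F \mPo excchart (P i) w u) m.+1]
  end.

Definition conic_thru (j : 'I_6) (G : {mpoly K[3]}) : Prop :=
  [/\ G != 0, G \is 2.-homog & forall k, k != j -> G.@[P k] = 0].

Definition general_six : Prop :=
  [/\ forall i, nonzero3 (P i),
      forall i j k, uniq [:: i; j; k] -> det3 (P i) (P j) (P k) != 0
    & ~ (exists G : {mpoly K[3]}, [/\ G != 0, G \is 2.-homog &
                                     forall k, G.@[P k] = 0])].

End Config.

(* the line through a and b is tangent to V(F) at a: the restriction
   F(s a + t b) vanishes to order >= 2 at t = 0 *)
Definition tangent_at (F : {mpoly K[3]}) (a b : vec3) : Prop :=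
  forall m, m \in msupp (F \mPo [tuple (a k)%:MP * 'X_ord0 + (b k)%:MP * 'X_ord_max
                                | k < 3]) ->
    (2 <= m (ord_max : 'I_2))%N.

End CubicSurface.

(* Main.v *)
Require Import Defs.
From mathcomp Require Import all_boot all_order all_algebra.
From mathcomp Require Import reals.
From mathcomp.real_closed Require Import complex.
From mathcomp Require Import mpoly.
From mathcomp Require Import ring zify.

(** The conditions on alpha only say that some cubic [F] through the six points has a
    triple point (on the blow-up) at every point of [Z]; degree [0] divisors are constants.

    In coordinates [x, y, z] adapted to a basis [p, w, u] of [K^3], multiplicity at [p] is
    the weight [(0,1,1)] order of [F], and multiplicity on the exceptional curve over [p]
    in the direction of [w] is its weight [(0,1,2)] order.

    If [F] has a triple point at [q] off the [P_i], then [F] is a binary cubic in [y, z],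
    so the [P_i] lie on at most three lines through [q]; each line carries at most two of
    them, hence the six points are paired by three lines through [q]. If [F] has a triple
    point on [E_i] in the direction of [w], then
    [F = z * (c1 x z + c2 y^2 + c3 y z + c4 z^2)]: a line through [P_i] times a conic
    tangent to it at [P_i]. The six points are not on the conic, so the line contains a
    second point [P_j] and the conic contains the five others. Uniqueness of the point of
    [Z] follows by restricting [F] to lines, and conversely three lines, or a line and a
    conic, give the required cubic. *)

Set Implicit Arguments.
Unset Strict Implicit.
Unset Printing Implicit Defensive.

Import GRing.Theory Num.Theory.
Local Open Scope ring_scope.

(** The indices are written as iterated lifts, the shape that [big_ord_recl] produces, so that
    expanded sums and determinants match them syntactically. *)
Local Notation i0 := (@ord0 2).
Local Notation i1 := (lift (@ord0 2) (@ord0 1)).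
Local Notation i2 := (lift (@ord0 2) (lift (@ord0 1) (@ord0 0))).

Lemma ord3_ind (T : 'I_3 -> Prop) : T i0 -> T i1 -> T i2 -> forall i, T i.
Proof.
move=> T0 T1 T2 [[|[|[|//]]] h].
- by rewrite (_ : Ordinal h = i0) //; apply: val_inj.
- by rewrite (_ : Ordinal h = i1) //; apply: val_inj.
- by rewrite (_ : Ordinal h = i2) //; apply: val_inj.
Qed.

(** * Weighted order of multivariate polynomials *)

Section Weights.
Variable K : comNzRingType.

Definition wt n (w : 'I_n -> nat) (m : 'X_{1..n}) : nat := (\sum_i w i * m i)%N.

Definition wt_ge n (w : 'I_n -> nat) (p : {mpoly K[n]}) (k : nat) : Prop :=
  forall m, m \in msupp p -> (k <= wt w m)%N.

Lemma wtD n (w : 'I_n -> nat) m1 m2 : wt w (m1 + m2)%MM = (wt w m1 + wt w m2)%N.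
Proof. by rewrite /wt -big_split; apply: eq_bigr => i _; rewrite mnmDE mulnDr. Qed.

Lemma wt_ge_leq n (w : 'I_n -> nat) p k l : (l <= k)%N -> wt_ge w p k -> wt_ge w p l.
Proof. by move=> lk h m /h; apply: leq_trans. Qed.

Lemma wt_ge0 n (w : 'I_n -> nat) k : wt_ge w 0 k.
Proof. by move=> m; rewrite msupp0. Qed.

Lemma wt_geC n (w : 'I_n -> nat) c : wt_ge w c%:MP 0.
Proof. by []. Qed.

Lemma wt_geD n (w : 'I_n -> nat) p q k :
  wt_ge w p k -> wt_ge w q k -> wt_ge w (p + q) k.
Proof. by move=> hp hq m /msuppD_le; rewrite mem_cat => /orP[/hp|/hq]. Qed.

Lemma wt_geZ n (w : 'I_n -> nat) c p k : wt_ge w p k -> wt_ge w (c *: p) k.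
Proof. by move=> hp m /msuppZ_le /hp. Qed.

Lemma wt_geM n (w : 'I_n -> nat) p q k l :
  wt_ge w p k -> wt_ge w q l -> wt_ge w (p * q) (k + l).
Proof.
move=> hp hq m /msuppM_le /allpairsP[[m1 m2]] /= [/hp h1 /hq h2 ->].
by rewrite wtD leq_add.
Qed.

Lemma wt_geX n (w : 'I_n -> nat) p k e : wt_ge w p k -> wt_ge w (p ^+ e) (k * e).
Proof.
move=> hp; elim: e => [|e IH]; first by rewrite expr0 muln0.
by rewrite exprS mulnS; apply: wt_geM.
Qed.

Lemma wt_ge_sum n (w : 'I_n -> nat) (I : eqType) (r : seq I) (f : I -> {mpoly K[n]}) k :
  (forall i, i \in r -> wt_ge w (f i) k) -> wt_ge w (\sum_(i <- r) f i) k.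
Proof.
elim: r => [|x r IH] h; first by rewrite big_nil; apply: wt_ge0.
rewrite big_cons; apply: wt_geD; first by apply: h; rewrite mem_head.
by apply: IH => i ir; apply: h; rewrite in_cons ir orbT.
Qed.

Lemma wt_ge_mono n (w : 'I_n -> nat) m : wt_ge w 'X_[m] (wt w m).
Proof. by move=> m'; rewrite msuppX inE => /eqP ->. Qed.

Lemma wtU n (w : 'I_n -> nat) i : wt w U_(i)%MM = w i.
Proof.
rewrite /wt (bigD1 i) //= mnm1E eqxx muln1 big1 ?addn0 // => j ji.
by rewrite mnm1E eq_sym (negbTE ji) muln0.
Qed.

Lemma wt_geXU n (w : 'I_n -> nat) i : wt_ge w ('X_i : {mpoly K[n]}) (w i).
Proof. by rewrite -[X in wt_ge _ _ X](wtU w i); apply: wt_ge_mono. Qed.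

(** Order is superadditive on products, so a monomial of weight [k] becomes a product of order at
    least [k]. Order bounds pass through charts and changes of basis in this way. *)
Lemma wt_ge_comp n n' (w : 'I_n -> nat) (w' : 'I_n' -> nat)
    (p : {mpoly K[n]}) (T : n.-tuple {mpoly K[n']}) k :
  (forall i, wt_ge w' (tnth T i) (w i)) -> wt_ge w p k -> wt_ge w' (p \mPo T) k.
Proof.
move=> hT hp; rewrite comp_mpolyEX; apply: wt_ge_sum => m /hp km.
apply: wt_geZ; apply: wt_ge_leq km _; rewrite comp_mpolyX /wt.
elim/big_rec2: _ => [|i a b _ hb]; first exact: wt_geC.
by apply: wt_geM => //; apply: wt_geX.
Qed.

Lemma eq_comp_mpoly n n' (p : {mpoly K[n]}) (T S : n.-tuple {mpoly K[n']}) :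
  tnth T =1 tnth S -> p \mPo T = p \mPo S.
Proof. by move=> /eq_from_tnth ->. Qed.

Lemma comp_mpolyA n n' n'' (p : {mpoly K[n]}) (T : n.-tuple {mpoly K[n']})
    (S : n'.-tuple {mpoly K[n'']}) :
  (p \mPo T) \mPo S = p \mPo [tuple (tnth T i) \mPo S | i < n].
Proof.
rewrite [p \mPo T]comp_mpolyEX [RHS]comp_mpolyEX raddf_sum.
apply: eq_bigr => m _; rewrite /= comp_mpolyZ !comp_mpolyX rmorph_prod.
by congr (_ *: _); apply: eq_bigr => i _; rewrite rmorphXn tnth_mktuple.
Qed.

(** A monomial substitution acts on exponents by [phi]; injectivity of [phi] on the support rules
    out cancellation, so each coefficient survives unchanged. *)
Lemma msupp_comp_mono n n' (p : {mpoly K[n]}) (t : 'I_n -> 'X_{1..n'}) mu :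
  let phi (m : 'X_{1..n}) := (\sum_i t i *+ m i)%MM in
  {in msupp p &, injective phi} -> mu \in msupp p ->
  phi mu \in msupp (p \mPo [tuple 'X_[t i] | i < n]).
Proof.
move=> phi inj mup; rewrite mcoeff_msupp comp_mpolyEX raddf_sum /=.
have E m : 'X_[m] \mPo [tuple 'X_[K, t i] | i < n] = 'X_[K, phi m].
  rewrite comp_mpolyX /phi; elim/big_rec2: _ => [|i a b _ ->]; first by rewrite mpolyX0.
  by rewrite tnth_mktuple mpolyXn mpolyXD.
rewrite (bigD1_seq mu) ?msupp_uniq //= E mcoeffZ mcoeffX eqxx mulr1.
rewrite big_seq_cond big1 ?addr0 -?mcoeff_msupp // => m /andP[mp mmu].
rewrite E mcoeffZ mcoeffX; case: eqP => [/inj e|_]; last by rewrite mulr0.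
by rewrite e ?eqxx in mmu.
Qed.

(** A converse to [wt_ge_comp] for monomial substitutions: without cancellation, every monomial of
    [p] is still visible after substitution, with its weight as degree. *)
Lemma wt_ge_comp_mono n n' (p : {mpoly K[n]}) (t : 'I_n -> 'X_{1..n'}) (w : 'I_n -> nat) k :
  {in msupp p &, injective (fun m : 'X_{1..n} => \sum_i t i *+ m i)%MM} ->
  (forall i, mdeg (t i) = w i) ->
  (forall m, m \in msupp (p \mPo [tuple 'X_[t i] | i < n]) -> (k <= mdeg m)%N) ->
  wt_ge w p k.
Proof.
move=> inj tw h m mp; have := h _ (msupp_comp_mono inj mp).
rewrite mdeg_sum /wt; congr (_ <= _)%N.
by apply: eq_bigr => i _; rewrite mdegMn tw.
Qed.

Lemma msupp_sub_sum n (p : {mpoly K[n]}) (s : seq 'X_{1..n}) :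
  uniq s -> {subset msupp p <= s} -> p = \sum_(m <- s) p@_m *: 'X_[m].
Proof.
move=> us sub; apply/mpolyP => m; rewrite raddf_sum /=.
under eq_bigr => m' _ do rewrite mcoeffZ mcoeffX.
have [ms|ms] := boolP (m \in s).
  rewrite (bigD1_seq m) //= eqxx mulr1 big1 ?addr0 // => m' ne.
  by rewrite (negbTE ne) mulr0.
rewrite big_seq big1 => [|m' m's].
  by apply/eqP; rewrite mcoeff_eq0; apply: contra ms => /sub.
by case: eqP => [e|]; rewrite ?mulr0 //; rewrite -e m's in ms.
Qed.

Lemma dhomog_comp n n' (p : {mpoly K[n]}) (T : n.-tuple {mpoly K[n']}) d :
  (forall i, tnth T i \is 1.-homog) -> p \is d.-homog -> p \mPo T \is d.-homog.
Proof.
move=> hT /dhomogP hp; rewrite comp_mpolyEX big_seq.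
apply: rpred_sum => m /hp dm; apply: rpredZ; rewrite comp_mpolyX -dm /= mdegE.
apply: (big_rec2 (fun a b => a \is b.-homog)) => [|i a b _ hb].
  exact: dhomog1.
by apply: dhomogM => //; rewrite -[X in X.-homog]mul1n; apply: dhomogMn.
Qed.

Lemma det33E (A : comNzRingType) (M : 'I_3 -> 'I_3 -> A) :
  \det (\matrix_(r < 3, s < 3) M r s) =
  M i0 i0 * (M i1 i1 * M i2 i2 - M i1 i2 * M i2 i1)
  - M i0 i1 * (M i1 i0 * M i2 i2 - M i1 i2 * M i2 i0)
  + M i0 i2 * (M i1 i0 * M i2 i1 - M i1 i1 * M i2 i0).
Proof.
rewrite (expand_det_row _ ord0) !big_ord_recl big_ord0 /cofactor.
rewrite !(expand_det_row _ ord0) !big_ord_recl !big_ord0 /cofactor.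
rewrite !det_mx11 !mxE /=.
have e1 (j : 'I_1): lift i1 (lift ord0 j) = i2 by rewrite (ord1 j); apply: val_inj.
have e2 : lift i1 (ord0 : 'I_2) = i0 by apply: val_inj.
have e3 : lift i2 (ord0 : 'I_2) = i0 by apply: val_inj.
have e4 (j : 'I_1): lift i2 (lift ord0 j) = i1 by rewrite (ord1 j); apply: val_inj.
have e5 (j : 'I_1) : lift (lift ord0 j) (ord0 : 'I_1) = (ord0 : 'I_2).
  by rewrite (ord1 j); apply: val_inj.
rewrite !e5 !e1 !e2 !e3 !e4 /= !ord1 /bump /=; ring.
Qed.

End Weights.

(** * Charts and adapted bases *)

Section Plane.
Variable R : rcfType.
Local Notation K := (R[i]).
Implicit Types (p q w u v a b c : vec3 R) (F G : {mpoly K[3]}).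

Lemma det3E a b c :
  det3 a b c = a i0 * (b i1 * c i2 - b i2 * c i1)
    - a i1 * (b i0 * c i2 - b i2 * c i0) + a i2 * (b i0 * c i1 - b i1 * c i0).
Proof. by rewrite /det3 det33E. Qed.

Lemma line_polyE a b :
  line_poly a b = (a i1 * b i2 - a i2 * b i1)%:MP * 'X_i0
    + (a i2 * b i0 - a i0 * b i2)%:MP * 'X_i1
    + (a i0 * b i1 - a i1 * b i0)%:MP * 'X_i2.
Proof. by rewrite /line_poly det33E /= !mpolyCB !mpolyCM; ring. Qed.

Lemma line_poly_eval a b v : (line_poly a b).@[v] = det3 a b v.
Proof.
by rewrite line_polyE !mevalD !mevalM !mevalC !mevalXU det3E; ring.
Qed.

Lemma line_poly_homog a b : line_poly a b \is 1.-homog.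
Proof.
rewrite line_polyE !mul_mpolyC.
by do !apply: rpredD; apply: rpredZ; rewrite dhomogX; apply/eqP; exact: mdeg1.
Qed.

Definition comb3 (x : K) p (y : K) w (z : K) u : vec3 R :=
  fun k => x * p k + y * w k + z * u k.

Lemma cramer p w u v : det3 p w u != 0 ->
  exists x y z, v =1 comb3 x p y w z u.
Proof.
move=> D0; exists (det3 v w u / det3 p w u), (det3 p v u / det3 p w u),
  (det3 p w v / det3 p w u).
move: D0; rewrite /comb3 !det3E => D0.
by apply: ord3_ind; field.
Qed.

(** The determinants against the standard basis vectors are, up to sign, the 2 by 2 minors of [p]
    and [w]; if all vanish, the two vectors are proportional. *)
Lemma det3_extend p w : ~ proportional p w -> exists u, det3 p w u != 0.
Proof.
move=> np.
pose e (k : 'I_3) : vec3 R := fun l => (l == k)%:R.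
have [h0|] := eqVneq (det3 p w (e i0)) 0; last by exists (e i0).
have [h1|] := eqVneq (det3 p w (e i1)) 0; last by exists (e i1).
have [h2|] := eqVneq (det3 p w (e i2)) 0; last by exists (e i2).
case: np; move: h0 h1 h2; rewrite !det3E /e /=.
rewrite ?eqxx ?mulr0 ?mulr1 ?subr0 ?sub0r ?addr0 ?add0r.
move=> /eqP h0 /eqP h1 /eqP h2.
have {}h0 : p i1 * w i2 = p i2 * w i1.
  by apply/eqP; rewrite -subr_eq0; apply/eqP; rewrite -(eqP h0); ring.
have {}h1 : p i0 * w i2 = p i2 * w i0.
  by apply/eqP; rewrite -subr_eq0 -oppr_eq0; apply/eqP; rewrite -(eqP h1); ring.
have {}h2 : p i0 * w i1 = p i1 * w i0.
  by apply/eqP; rewrite -subr_eq0; apply/eqP; rewrite -(eqP h2); ring.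
by apply: ord3_ind; apply: ord3_ind.
Qed.

Lemma det3_basis p : nonzero3 p -> exists w u, det3 p w u != 0.
Proof.
case=> k pk.
have [w] : exists w, ~ proportional p w.
  exists (fun l => if k == i0 then (l == i1)%:R else (l == i0)%:R) => h.
  move: pk; case: (eqVneq k i0) h => [->|ki] h.
    by have := h i0 i1; rewrite /= mulr1 mulr0 => ->; rewrite eqxx.
  have := h k i0; rewrite /= (negbTE ki) mulr1 mulr0 => ->; by rewrite eqxx.
by move=> /det3_extend [u]; exists w, u.
Qed.

Definition combT n p w u (A B C : {mpoly K[n]}) : 3.-tuple {mpoly K[n]} :=
  [tuple (p k)%:MP * A + (w k)%:MP * B + (u k)%:MP * C | k < 3].

Definition in_basis F p w u : {mpoly K[3]} := F \mPo combT p w u 'X_i0 'X_i1 'X_i2.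

Lemma combT_eval n F p w u (A B C : {mpoly K[n]}) (v : 'I_n -> K) :
  (F \mPo combT p w u A B C).@[v] = F.@[comb3 A.@[v] p B.@[v] w C.@[v] u].
Proof.
rewrite comp_mpoly_meval; apply: meval_eq => k.
by rewrite tnth_mktuple !mevalD !mevalM !mevalC /comb3; ring.
Qed.

Definition vec (x y z : K) : vec3 R :=
  fun k => if k == i0 then x else if k == i1 then y else z.

Lemma in_basis_eval F p w u x y z :
  (in_basis F p w u).@[vec x y z] = F.@[comb3 x p y w z u].
Proof. by rewrite combT_eval !mevalXU. Qed.

(** Both charts parametrise combinations of [p], [w], [u], so composing with a chart amounts to
    passing to adapted coordinates and then making a simple substitution. *)
Lemma in_basis_comp n F p w u (A B C : {mpoly K[n]}) :
  F \mPo combT p w u A B C = in_basis F p w u \mPo [tuple A; B; C].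
Proof.
have E := @comp_mpolyA K 3 3 n F (combT p w u 'X_i0 'X_i1 'X_i2) [tuple A; B; C].
rewrite {1}/in_basis {}E.
apply: eq_comp_mpoly => k.
rewrite !tnth_mktuple !comp_mpolyD !rmorphM /= !comp_mpolyC !comp_mpolyXU.
by [].
Qed.

Lemma in_basis_homog F p w u d : F \is d.-homog -> in_basis F p w u \is d.-homog.
Proof.
apply: dhomog_comp => k; rewrite tnth_mktuple !mul_mpolyC.
by do !apply: rpredD; apply: rpredZ; rewrite dhomogX; apply/eqP; exact: mdeg1.
Qed.

(** The base change is inverted by Cramer's rule: the coordinate forms are the [line_poly] of pairs
    of basis vectors, divided by the determinant. *)
Lemma in_basis_eq0 F p w u : det3 p w u != 0 -> in_basis F p w u = 0 -> F = 0.
Proof.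
move=> D0 F0; rewrite -[F]comp_mpoly_id.
rewrite (_ : [tuple _ | _ < _] = combT p w u ((det3 p w u)^-1 *: line_poly w u)
    ((det3 p w u)^-1 *: line_poly u p) ((det3 p w u)^-1 *: line_poly p w)).
  by rewrite in_basis_comp F0 comp_mpoly0.
apply/eq_from_tnth => k; rewrite !tnth_mktuple.
rewrite -!scalerAr -!scalerDr.
transitivity ((det3 p w u)^-1 *: (det3 p w u *: ('X_k : {mpoly K[3]}))).
  by rewrite scalerA mulVf // scale1r.
congr (_ *: _); rewrite !line_polyE det3E -mul_mpolyC.
rewrite !(mpolyCB, mpolyCD, mpolyCM).
by move: k; apply: ord3_ind; ring.
Qed.

Lemma offchart_comp F p w u :
  F \mPo offchart p w u = in_basis F p w u \mPo [tuple 1; 'X_ord0; 'X_ord_max].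
Proof.
rewrite -in_basis_comp; apply: eq_comp_mpoly => k.
by rewrite !tnth_mktuple mulr1.
Qed.

Lemma excchart_comp F p w u :
  F \mPo excchart p w u =
  in_basis F p w u \mPo [tuple 1; 'X_ord0; 'X_ord0 * 'X_ord_max].
Proof.
rewrite -in_basis_comp; apply: eq_comp_mpoly => k.
by rewrite !tnth_mktuple mulr1 mulrA.
Qed.

Lemma mono_geE n (p : {mpoly K[n]}) k : mono_ge p k <-> wt_ge (fun=> 1%N) p k.
Proof.
have E m : wt (fun=> 1%N) m = mdeg m :> nat.
  by rewrite /wt mdegE; apply: eq_bigr => i _; rewrite mul1n.
by split=> h m /h; rewrite E.
Qed.

Lemma mono_geM n (p q : {mpoly K[n]}) k l :
  mono_ge p k -> mono_ge q l -> mono_ge (p * q) (k + l).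
Proof. by move=> /mono_geE hp /mono_geE hq; apply/mono_geE; apply: wt_geM. Qed.

Lemma mono_ge_leq n (p : {mpoly K[n]}) k l : (l <= k)%N -> mono_ge p k -> mono_ge p l.
Proof. by move=> lk h m /h; apply: leq_trans. Qed.

Lemma mono_ge1 n (p : {mpoly K[n]}) : p.@[fun=> 0] = 0 -> mono_ge p 1.
Proof.
move=> p0 m; rewrite lt0n; apply: contraTneq => /eqP; rewrite mdeg_eq0 => /eqP ->.
rewrite mcoeff_msupp negbK; apply/eqP; rewrite -[RHS]p0 {2}(mpolyE p) raddf_sum /=.
have E m' : ('X_[m'] : {mpoly K[n]}).@[fun=> 0] = (m' == 0%MM)%:R.
  rewrite mevalX; case: eqVneq => [->|]; first by rewrite big1 // => i _; rewrite mnm0E.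
  rewrite -mdeg_eq0 mdegE sum_nat_eq0 negb_forall => /existsP[j]; rewrite implyTb => mj.
  by rewrite (bigD1 j) //= expr0n (negbTE mj) mul0r.
under eq_bigr => m' _ do rewrite mevalZ E.
have [h|h] := boolP (0%MM \in msupp p).
  rewrite (bigD1_seq 0%MM) ?msupp_uniq //= eqxx mulr1 big1 ?addr0 // => m' ne.
  by rewrite (negbTE ne) mulr0.
rewrite (memN_msupp_eq0 h) big_seq big1 // => m' m's; case: eqP => [e|]; rewrite ?mulr0 //.
by rewrite -e m's in h.
Qed.

Lemma mult_plane_ge1 F q : F.@[q] = 0 -> mult_plane_ge F q 1.
Proof.
move=> Fq w u _; apply: mono_ge1; rewrite comp_mpoly_meval -[RHS]Fq.
apply: meval_eq => k; rewrite tnth_mktuple !mevalD !mevalM !mevalC !mevalXU.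
by rewrite !mulr0 !addr0.
Qed.

(** The chart sets [x = 1], [y = s], [z = s t], so [x^a y^b z^c] becomes [s^(b+c) t^c], of degree
    [b + 2 c]. In a fixed degree the pair [(b+c, c)] determines [a], [b], [c], so nothing cancels
    and the two orders agree. *)
Lemma excchart_wt F p w u d k : F \is d.-homog ->
  mono_ge (F \mPo excchart p w u) k <-> wt_ge (@nat_of_ord 3) (in_basis F p w u) k.
Proof.
move=> Fd; rewrite excchart_comp; have := in_basis_homog p w u Fd.
move: (in_basis F p w u) => {}F {}Fd; split; last first.
  move=> h; apply/mono_geE; apply: wt_ge_comp h; apply: ord3_ind.
  - exact: wt_geC.
  - exact: (@wt_geXU K 2 (fun=> 1%N) ord0).
  - exact: (wt_geM (@wt_geXU K 2 (fun=> 1%N) ord0) (@wt_geXU K 2 (fun=> 1%N) ord_max)).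
pose t (i : 'I_3) : 'X_{1..2} :=
  tnth [tuple 0%MM; U_(ord0)%MM; (U_(ord0) + U_(ord_max))%MM] i.
have -> : [tuple 1; 'X_ord0; 'X_ord0 * 'X_ord_max] = [tuple 'X_[K, t i] | i < 3].
  apply/eq_from_tnth => i; rewrite tnth_mktuple; move: i; apply: ord3_ind => //.
  - by rewrite /t /= mpolyX0.
  - by rewrite /t /= mpolyXD.
apply: wt_ge_comp_mono; last first.
  by apply: ord3_ind; rewrite /t !(tnth_nth 0%MM) /= ?mdegD ?mdeg0 ?mdeg1.
have E (m : 'X_{1..3}) : ((\sum_i t i *+ m i)%MM ord0 = m i1 + m i2)%N /\
    ((\sum_i t i *+ m i)%MM ord_max = m i2)%N.
  rewrite !mnm_sumE !big_ord_recl !big_ord0 /t !mulmnE !(tnth_nth 0%MM) /=.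
  by rewrite !mnmDE !mnm0E !mnm1E /=; lia.
move=> m m' /(dhomog_mf Fd) dm /(dhomog_mf Fd) dm' e; apply/mnmP.
move: dm dm'; rewrite /= !mdegE !big_ord_recl !big_ord0 => dm dm'.
have [h1 h2] := E m; have [h3 h4] := E m'; rewrite e in h1 h2.
by apply: ord3_ind; lia.
Qed.

(** Here [x = 1], [y = s], [z = t]: the chart keeps the exponents [b], [c], and homogeneity recovers
    [a]. *)
Lemma offchart_wt F p w u d k : F \is d.-homog ->
  mono_ge (F \mPo offchart p w u) k ->
  wt_ge (fun i : 'I_3 => nat_of_bool (0 < i)%N) (in_basis F p w u) k.
Proof.
move=> Fd; rewrite offchart_comp; have := in_basis_homog p w u Fd.
move: (in_basis F p w u) => {}F {}Fd.
pose t (i : 'I_3) : 'X_{1..2} := tnth [tuple 0%MM; U_(ord0)%MM; U_(ord_max)%MM] i.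
have -> : [tuple 1; 'X_ord0; 'X_ord_max] = [tuple 'X_[K, t i] | i < 3].
  apply/eq_from_tnth => i; rewrite tnth_mktuple; move: i; apply: ord3_ind => //.
  by rewrite /t /= mpolyX0.
apply: wt_ge_comp_mono; last first.
  by apply: ord3_ind; rewrite /t !(tnth_nth 0%MM) /= ?mdeg0 ?mdeg1.
have E (m : 'X_{1..3}) : ((\sum_i t i *+ m i)%MM ord0 = m i1)%N /\
    ((\sum_i t i *+ m i)%MM ord_max = m i2)%N.
  rewrite !mnm_sumE !big_ord_recl !big_ord0 /t !mulmnE !(tnth_nth 0%MM) /=.
  by rewrite !mnm0E !mnm1E /=; lia.
move=> m m' /(dhomog_mf Fd) dm /(dhomog_mf Fd) dm' e; apply/mnmP.
move: dm dm'; rewrite /= !mdegE !big_ord_recl !big_ord0 => dm dm'.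
have [h1 h2] := E m; have [h3 h4] := E m'; rewrite e in h1 h2.
by apply: ord3_ind; lia.
Qed.

End Plane.

(** * Normal forms of cubics with a triple point *)

Section Forms.
Variable R : rcfType.
Local Notation K := (R[i]).
Implicit Types (p q w u v a b c : vec3 R) (F G : {mpoly K[3]}).

Lemma line_poly_combT n a b p w u (A B C : {mpoly K[n]}) :
  line_poly a b \mPo combT p w u A B C =
  (det3 a b p)%:MP * A + (det3 a b w)%:MP * B + (det3 a b u)%:MP * C.
Proof.
rewrite line_polyE !comp_mpolyD !rmorphM /= !comp_mpolyC !comp_mpolyXU.
rewrite -!tnth_nth !tnth_mktuple !det3E.
by rewrite !(mpolyCB, mpolyCD, mpolyCM); ring.
Qed.

Lemma det3_comb3 p w u x y z : det3 p w (comb3 x p y w z u) = z * det3 p w u.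
Proof. by rewrite !det3E /comb3; ring. Qed.

Lemma eq_det3 a b c c' : c =1 c' -> det3 a b c = det3 a b c'.
Proof. by move=> e; rewrite !det3E !e. Qed.

(** The order depends only on the tangent direction at [p]: the change of basis is triangular and
    replaces no variable by terms of lower [(0,1,2)] weight. *)
Lemma excchart_transfer F d p w u w' u' k :
  F \is d.-homog -> det3 p w u != 0 -> det3 p w w' = 0 ->
  mono_ge (F \mPo excchart p w u) k -> mono_ge (F \mPo excchart p w' u') k.
Proof.
move=> Fd D0 pww' /(excchart_wt _ _ _ _ Fd) h; apply/(excchart_wt _ _ _ _ Fd).
(* Since [w'] lies on the line [p w], it has no component along [u]; this is what makes the base
   change triangular. *)
have [x [y [z ew]]] := cramer w' D0.
have [x' [y' [z' eu]]] := cramer u' D0.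
have z0 : z = 0.
  move: pww'; rewrite (eq_det3 _ _ ew) det3_comb3 => /eqP.
  by rewrite mulf_eq0 (negbTE D0) orbF => /eqP.
have -> : in_basis F p w' u' = in_basis F p w u \mPo
    [tuple 'X_i0 + x *: 'X_i1 + x' *: 'X_i2; y *: 'X_i1 + y' *: 'X_i2; z' *: 'X_i2].
  rewrite -in_basis_comp; apply: eq_comp_mpoly => l.
  rewrite !tnth_mktuple ew eu /comb3 z0 -!mul_mpolyC.
  by rewrite !(mpolyCD, mpolyCM); ring.
apply: wt_ge_comp h.
have X0 : wt_ge (@nat_of_ord 3) ('X_i0 : {mpoly K[3]}) 0 by [].
have X1 : wt_ge (@nat_of_ord 3) ('X_i1 : {mpoly K[3]}) 1.
  exact: (@wt_geXU K 3 (@nat_of_ord 3) i1).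
have X2 : wt_ge (@nat_of_ord 3) ('X_i2 : {mpoly K[3]}) 2.
  exact: (@wt_geXU K 3 (@nat_of_ord 3) i2).
apply: ord3_ind => //=.
- by apply: wt_geD; apply: wt_geZ => //; apply: wt_ge_leq X2.
- exact: wt_geZ.
Qed.

Definition mn (a b c : nat) : 'X_{1..3} :=
  (U_(i0) *+ a + U_(i1) *+ b + U_(i2) *+ c)%MM.

Lemma mnE (m : 'X_{1..3}) : m = mn (m i0) (m i1) (m i2).
Proof.
by apply/mnmP; apply: ord3_ind; rewrite /mn !mnmDE !mulmnE !mnm1E /=; lia.
Qed.

Lemma mn_eq (a b c a' b' c' : nat) :
  (mn a b c == mn a' b' c') = [&& a == a', b == b' & c == c'].
Proof.
apply/eqP/and3P => [e|[/eqP-> /eqP-> /eqP->] //].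
have := congr1 (fun m : 'X_{1..3} => m i0) e.
have := congr1 (fun m : 'X_{1..3} => m i1) e.
have := congr1 (fun m : 'X_{1..3} => m i2) e.
rewrite /mn !mnmDE !mulmnE !mnm1E /= => h2 h1 h0.
by split; apply/eqP; lia.
Qed.

Lemma mn_eval (a b c : nat) (x y z : K) :
  ('X_[mn a b c] : {mpoly K[3]}).@[vec x y z] = x ^+ a * y ^+ b * z ^+ c.
Proof. by rewrite /mn !mpolyXD -!mpolyXn !mevalM !rmorphXn /= !mevalXU. Qed.

Lemma mdeg3 (m : 'X_{1..3}) : mdeg m = (m i0 + m i1 + m i2)%N.
Proof. by rewrite mdegE !big_ord_recl big_ord0 addn0 addnA. Qed.

(** In degree 3, weight [(0,1,1)] at least 3 leaves no room for [x], so only the four cubic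
    monomials in [y], [z] survive. *)
Lemma offchart_cubic F q w u :
  F != 0 -> F \is 3.-homog -> det3 q w u != 0 ->
  mono_ge (F \mPo offchart q w u) 3 ->
  exists c1 c2 c3 c4 : K,
    (forall x y z, F.@[comb3 x q y w z u] =
       c1 * y ^+ 3 + c2 * y ^+ 2 * z + c3 * y * z ^+ 2 + c4 * z ^+ 3) /\
    ~ [/\ c1 = 0, c2 = 0, c3 = 0 & c4 = 0].
Proof.
move=> F0 F3 D0 /(offchart_wt F3) h.
have H3 := in_basis_homog q w u F3.
have N0 : in_basis F q w u <> 0 by move/(in_basis_eq0 D0)/eqP; rewrite (negbTE F0).
have E := in_basis_eval F q w u.
move: (in_basis F q w u) => H in h H3 N0 E.
have EH : H = \sum_(m <- [:: mn 0 3 0; mn 0 2 1; mn 0 1 2; mn 0 0 3]) H@_m *: 'X_[m].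
  apply: msupp_sub_sum; first by rewrite /= !inE !mn_eq.
  move=> m ms; have := h m ms; have := dhomog_mf H3 ms.
  rewrite /= mdeg3 /wt !big_ord_recl big_ord0 /= (mnE m) !inE !mn_eq.
  by rewrite -!mnE; lia.
exists H@_(mn 0 3 0), H@_(mn 0 2 1), H@_(mn 0 1 2), H@_(mn 0 0 3); split.
  move=> x y z; rewrite -E {1}EH !big_cons big_nil !mevalD !mevalZ meval0 !mn_eval.
  by move: (H@__) (H@__) (H@__) (H@__) => d1 d2 d3 d4; ring.
by case=> h1 h2 h3 h4; apply: N0; rewrite EH !big_cons big_nil h1 h2 h3 h4 !scale0r !addr0.
Qed.

(** The bound 4 is [m + d] with [m = 3] and [d = 1]. The cubic monomials with [b + 2 c >= 4] are
    [x z^2], [y^2 z], [y z^2] and [z^3], all divisible by [z]. *)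
Lemma excchart_cubic F p w u :
  F != 0 -> F \is 3.-homog -> det3 p w u != 0 ->
  mono_ge (F \mPo excchart p w u) 4 ->
  exists c1 c2 c3 c4 : K,
    (forall x y z, F.@[comb3 x p y w z u] =
       z * (c1 * x * z + c2 * y ^+ 2 + c3 * y * z + c4 * z ^+ 2)) /\
    ~ [/\ c1 = 0, c2 = 0, c3 = 0 & c4 = 0].
Proof.
move=> F0 F3 D0 /(excchart_wt _ _ _ _ F3) h.
have H3 := in_basis_homog p w u F3.
have N0 : in_basis F p w u <> 0 by move/(in_basis_eq0 D0)/eqP; rewrite (negbTE F0).
have E := in_basis_eval F p w u.
move: (in_basis F p w u) => H in h H3 N0 E.
have EH : H = \sum_(m <- [:: mn 1 0 2; mn 0 2 1; mn 0 1 2; mn 0 0 3]) H@_m *: 'X_[m].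
  apply: msupp_sub_sum; first by rewrite /= !inE !mn_eq.
  move=> m ms; have := h m ms; have := dhomog_mf H3 ms.
  rewrite /= mdeg3 /wt !big_ord_recl big_ord0 /= (mnE m) !inE !mn_eq.
  by rewrite -!mnE /bump /=; lia.
exists H@_(mn 1 0 2), H@_(mn 0 2 1), H@_(mn 0 1 2), H@_(mn 0 0 3); split.
  move=> x y z; rewrite -E {1}EH !big_cons big_nil !mevalD !mevalZ meval0 !mn_eval.
  by move: (H@__) (H@__) (H@__) (H@__) => d1 d2 d3 d4; ring.
by case=> h1 h2 h3 h4; apply: N0; rewrite EH !big_cons big_nil h1 h2 h3 h4 !scale0r !addr0.
Qed.

(** * Conics through [p] tangent to the line [p w] *)

Section TangentConic.
Variables (p w u : vec3 R) (c1 c2 c3 c4 : K).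
Hypothesis D0 : det3 p w u != 0.

(** [X], [Y], [Z] are the linear forms dual to the basis [p], [w], [u]. When [c1 != 0] the conic is
    smooth at [p], with tangent line [Z = 0]. *)
Definition tangent_conic : {mpoly K[3]} :=
  let D := (det3 p w u)^-1 in
  let X := D *: line_poly w u in
  let Y := D *: line_poly u p in
  let Z := D *: line_poly p w in
  c1 *: (X * Z) + c2 *: (Y * Y) + c3 *: (Y * Z) + c4 *: (Z * Z).

Lemma tangent_conic_homog : tangent_conic \is 2.-homog.
Proof.
rewrite /tangent_conic; do !apply: rpredD; apply: rpredZ;
  by apply: (@dhomogM _ _ _ 1%N _ 1%N); apply: rpredZ; apply: line_poly_homog.
Qed.

Lemma tangent_conic_combT n (A B C : {mpoly K[n]}) :
  tangent_conic \mPo combT p w u A B C =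
  c1 *: (A * C) + c2 *: (B * B) + c3 *: (B * C) + c4 *: (C * C).
Proof.
have V (c a : K) (Q : {mpoly K[n]}) : c = a -> (a != 0) -> a^-1 *: (c%:MP * Q) = Q.
  by move=> -> a0; rewrite mul_mpolyC scalerA mulVf // scale1r.
have e1 : (det3 p w u)^-1 *: line_poly w u \mPo combT p w u A B C = A.
  rewrite comp_mpolyZ line_poly_combT.
  have -> : det3 w u w = 0 by rewrite det3E; ring.
  have -> : det3 w u u = 0 by rewrite det3E; ring.
  rewrite !mpolyC0 !mul0r !addr0; apply: V => //; by rewrite !det3E; ring.
have e2 : (det3 p w u)^-1 *: line_poly u p \mPo combT p w u A B C = B.
  rewrite comp_mpolyZ line_poly_combT.
  have -> : det3 u p p = 0 by rewrite det3E; ring.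
  have -> : det3 u p u = 0 by rewrite det3E; ring.
  rewrite !mpolyC0 !mul0r !addr0 add0r; apply: V => //; by rewrite !det3E; ring.
have e3 : (det3 p w u)^-1 *: line_poly p w \mPo combT p w u A B C = C.
  rewrite comp_mpolyZ line_poly_combT.
  have -> : det3 p w p = 0 by rewrite det3E; ring.
  have -> : det3 p w w = 0 by rewrite det3E; ring.
  by rewrite !mpolyC0 !mul0r !add0r; apply: V.
have M X Y Z (T : 3.-tuple {mpoly K[n]}) : X \mPo T = A -> Y \mPo T = B -> Z \mPo T = C ->
    (c1 *: (X * Z) + c2 *: (Y * Y) + c3 *: (Y * Z) + c4 *: (Z * Z)) \mPo T =
    c1 *: (A * C) + c2 *: (B * B) + c3 *: (B * C) + c4 *: (C * C).
  by rewrite !comp_mpolyD !comp_mpolyZ !rmorphM /= => -> -> ->.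
exact: M e1 e2 e3.
Qed.

Lemma tangent_conic_eval x y z :
  tangent_conic.@[comb3 x p y w z u] =
  c1 * x * z + c2 * y ^+ 2 + c3 * y * z + c4 * z ^+ 2.
Proof.
have := combT_eval tangent_conic p w u (x%:MP : {mpoly K[3]}) y%:MP z%:MP (fun=> 0).
rewrite !mevalC => <-; rewrite tangent_conic_combT !mevalD !mevalZ !mevalM !mevalC.
by ring.
Qed.

(** The values at [(0,1,0)], [(0,0,1)], [(1,0,1)] and [(0,1,1)] recover the four coefficients one
    after another. *)
Lemma tangent_conic_neq0 : ~ [/\ c1 = 0, c2 = 0, c3 = 0 & c4 = 0] -> tangent_conic != 0.
Proof.
move=> h; apply/eqP => G0; apply: h.
have E x y z : c1 * x * z + c2 * y ^+ 2 + c3 * y * z + c4 * z ^+ 2 = 0.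
  by rewrite -tangent_conic_eval G0 meval0.
have h2 : c2 = 0 by have := E 0 1 0; rewrite !(mulr0, mulr1, expr0n, expr1n, addr0, add0r).
have h4 : c4 = 0 by rewrite -[RHS](E 0 0 1); ring.
have h1 : c1 = 0 by rewrite -[RHS](E 1 0 1) h4; ring.
have h3 : c3 = 0 by rewrite -[RHS](E 0 1 1) h4 h2; ring.
by [].
Qed.

Lemma mono_ge2_coef n (f : {mpoly K[n]}) k : mono_ge f 2 -> f@_U_(k) = 0.
Proof.
move=> h; apply/eqP; rewrite mcoeff_eq0; apply/negP => /h.
by rewrite mdeg1.
Qed.

(** In the affine chart at [p] the linear term is [c1 t], so the multiplicity there is exactly one.
    In the exceptional chart the equation is [c1 s t + c2 s^2 + c3 s^2 t + c4 s^2 t^2], of order at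
    least 2. *)
Lemma tangent_conic_on_proper u' :
  c1 != 0 -> [/\ mult_plane_ge tangent_conic p 1, ~ mult_plane_ge tangent_conic p 2 &
    mono_ge (tangent_conic \mPo excchart p w u') 2].
Proof.
move=> c10; split.
- apply: mult_plane_ge1.
  have := tangent_conic_eval 1 0 0; rewrite (@meval_eq _ _ _ p) => [->|k].
    by ring.
  by rewrite /comb3; ring.
- move=> /(_ w u D0) /mono_ge2_coef -/(_ ord_max) /eqP.
  rewrite offchart_comp -in_basis_comp tangent_conic_combT !mcoeffD !mcoeffZ mul1r.
  have X2 (k l : 'I_2) : ('X_k * 'X_l : {mpoly K[2]})@_U_(ord_max) = 0.
    by rewrite -mpolyXD mcoeffX; case: eqP => // /(congr1 mdeg); rewrite mdegD !mdeg1.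
  by rewrite !X2 mcoeffXU eqxx !mulr0 mulr1 !addr0 (negbTE c10).
- have D2 : det3 p w w = 0 by rewrite det3E; ring.
  suff h : mono_ge (tangent_conic \mPo excchart p w u) 2.
    exact: (excchart_transfer tangent_conic_homog D0 D2 h).
  rewrite excchart_comp -in_basis_comp tangent_conic_combT; apply/mono_geE.
  have X1 (k : 'I_2) : wt_ge (fun=> 1%N) ('X_k : {mpoly K[2]}) 1.
    exact: (@wt_geXU K 2 (fun=> 1%N) k).
  have X11 (k l : 'I_2) : wt_ge (fun=> 1%N) ('X_k * 'X_l : {mpoly K[2]}) 2.
    exact: (wt_geM (X1 k) (X1 l)).
  rewrite mul1r; do !apply: wt_geD; apply: wt_geZ => //.
  + exact: (wt_ge_leq _ (wt_geM (X1 _) (X11 _ _))).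
  + exact: (wt_ge_leq _ (wt_geM (X11 _ _) (X11 _ _))).
Qed.

(** On the line [p w] the third coordinate vanishes and the conic restricts to [c2 Y^2], where [Y]
    is a multiple of the parameter attached to [v]. *)
Lemma tangent_conic_tangent v x y :
  v =1 comb3 x p y w 0 u -> tangent_at tangent_conic p v.
Proof.
move=> ev m.
rewrite (@eq_comp_mpoly _ _ _ _ _
  (combT p w u ('X_ord0 + x%:MP * 'X_ord_max) (y%:MP * 'X_ord_max) 0)); last first.
  by move=> k; rewrite !tnth_mktuple ev /comb3 !(mpolyCD, mpolyCM) mpolyC0; ring.
rewrite tangent_conic_combT !mulr0 !scaler0 !addr0 add0r.
rewrite (_ : _ * _ = (y * y) *: ('X_[U_(ord_max) + U_(ord_max)]: {mpoly K[2]})); last first.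
  by rewrite mpolyXD -mul_mpolyC mpolyCM; ring.
move=> /msuppZ_le /msuppZ_le; rewrite msuppX inE => /eqP ->.
by rewrite mnmDE mnm1E eqxx.
Qed.

End TangentConic.

(** The line is a nonzero multiple of one coordinate in a chart at [p], hence of multiplicity one;
    in the exceptional chart along its own direction it becomes a multiple of [s t]. *)
Lemma line_poly_on_proper p b w u' : det3 p b w = 0 -> ~ proportional p b ->
  [/\ mult_plane_ge (line_poly p b) p 1, ~ mult_plane_ge (line_poly p b) p 2 &
    mono_ge (line_poly p b \mPo excchart p w u') 2].
Proof.
move=> Dw np.
have Dp : det3 p b p = 0 by rewrite det3E; ring.
have Db : det3 p b b = 0 by rewrite det3E; ring.
split.
- by apply: mult_plane_ge1; rewrite line_poly_eval.
- have [u Du] := det3_extend np.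
  move=> /(_ b u Du) /mono_ge2_coef -/(_ ord_max) /eqP.
  rewrite offchart_comp -in_basis_comp line_poly_combT Dp Db !mpolyC0 !mul0r !add0r.
  by rewrite mul_mpolyC mcoeffZ mcoeffXU eqxx mulr1 (negbTE Du).
- rewrite excchart_comp -in_basis_comp line_poly_combT Dp Dw !mpolyC0 !mul0r !add0r.
  rewrite mul_mpolyC -mpolyXD => m /msuppZ_le; rewrite msuppX inE => /eqP ->.
  by rewrite mdegD !mdeg1.
Qed.

End Forms.

(** * Cubics through six general points *)

Section SixPoints.

Lemma ex_notin (A : {set 'I_6}) : (#|A| < 6)%N -> exists x, x \notin A.
Proof.
move=> cA; have : (0 < #|~: A|)%N by rewrite cardsCs setCK card_ord subn_gt0.
by case/card_gt0P => x; rewrite inE; exists x.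
Qed.

Lemma ex_notin_seq (s : seq 'I_6) : (size s < 6)%N -> exists x, x \notin s.
Proof.
move=> ss; have [x] : exists x, x \notin [set y in s].
  by apply: ex_notin; rewrite cardsE; apply: leq_ltn_trans (card_size s) ss.
by rewrite inE; exists x.
Qed.

Lemma class_card2 (r : rel 'I_6) x :
  (forall x y, r x y = r y x) -> transitive r ->
  (forall x y z, uniq [:: x; y; z] -> r x y -> r x z -> False) ->
  (#|[set y | r x y]| <= 2)%N.
Proof.
move=> rs rt r3; rewrite leqNgt; apply/negP => /card_gt2P[a [b [c [[]]]]].
rewrite !inE => xa xb xc [ab bc ca]; apply: (r3 a b c).
- by rewrite /= !inE negb_or ab bc eq_sym ca.
- by apply: rt xb; rewrite rs.
- by apply: rt xc; rewrite rs.
Qed.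

(** Classes have at most two elements and there are at most three of them, so six indices force
    exactly three classes of size two. *)
Lemma pairing6 (r : rel 'I_6) :
  reflexive r -> (forall x y, r x y = r y x) -> transitive r ->
  (forall x y z, uniq [:: x; y; z] -> r x y -> r x z -> False) ->
  (forall a b c d, ~~ r a b -> ~~ r a c -> ~~ r a d -> ~~ r b c -> ~~ r b d ->
     ~~ r c d -> False) ->
  exists i j k l m n : 'I_6,
    [/\ uniq [:: i; j; k; l; m; n], r i j, r k l & r m n].
Proof.
move=> rr rs rt r3 r4.
pose C i := [set j | r i j].
have C2 x : (#|C x| <= 2)%N.
  exact: class_card2.
have CU (A B : {set 'I_6}) : (#|A :|: B| <= #|A| + #|B|)%N by rewrite leq_card_setU.
(* If the class of [x] were a singleton, it and the classes of [b] and [c] would cover at most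
   [1 + 2 + 2 = 5] indices, and a remaining [d] would give four pairwise unrelated ones. *)
have partner x : exists2 y, y != x & r x y.
  have [/existsP[y /andP[h1 h2]]|] := boolP [exists y, (y != x) && r x y].
    by exists y.
  rewrite negb_exists => /forallP h.
  have C1 : (#|C x| <= 1)%N.
    suff : C x \subset [set x] by move/subset_leq_card; rewrite cards1.
    apply/subsetP => y; rewrite !inE => xy.
    by have := h y; rewrite xy andbT negbK.
  have [b] : exists b : 'I_6, b \notin C x.
    by apply: ex_notin; apply: leq_ltn_trans C1 _.
  rewrite inE => xb.
  have [c] : exists c : 'I_6, c \notin C x :|: C b.
    apply: ex_notin; apply: leq_ltn_trans (CU _ _) _.
    exact: leq_ltn_trans (leq_add C1 (C2 b)) _.
  rewrite !inE negb_or => /andP[xc bc].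
  have [d] : exists d, d \notin C x :|: C b :|: C c.
    apply: ex_notin; apply: leq_ltn_trans (CU _ _) _.
    apply: leq_ltn_trans (leq_add (CU _ _) (leqnn _)) _.
    exact: leq_ltn_trans (leq_add (leq_add C1 (C2 b)) (C2 c)) _.
  rewrite !inE !negb_or => /andP[/andP[xd bd] cd].
  by case: (r4 x b c d).
have [j ji rij] := partner ord0.
have [k] : exists k, k \notin C ord0.
  by apply: ex_notin; apply: leq_ltn_trans (C2 _) _.
rewrite inE => ik.
have [l lk rkl] := partner k.
have [m] : exists m, m \notin C ord0 :|: C k.
  apply: ex_notin; apply: leq_ltn_trans (CU _ _) _.
  exact: leq_ltn_trans (leq_add (C2 _) (C2 _)) _.
rewrite !inE negb_or => /andP[im km].
have [n nm rmn] := partner m.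
exists ord0, j, k, l, m, n; split=> //.
have ne a a' b b' : r a a' -> r b b' -> ~~ r a b -> a' != b'.
  move=> aa bb; apply: contra => /eqP e; apply: rt aa _; rewrite e.
  by rewrite rs.
have il := ne _ _ _ _ (rr ord0) rkl ik; have jk := ne _ _ _ _ rij (rr k) ik.
have jl := ne _ _ _ _ rij rkl ik; have ikn := ne _ _ _ _ (rr ord0) (rr k) ik.
have i_m := ne _ _ _ _ (rr ord0) (rr m) im; have i_n := ne _ _ _ _ (rr ord0) rmn im.
have j_m := ne _ _ _ _ rij (rr m) im; have j_n := ne _ _ _ _ rij rmn im.
have k_m := ne _ _ _ _ (rr k) (rr m) km; have k_n := ne _ _ _ _ (rr k) rmn km.
have l_m := ne _ _ _ _ rkl (rr m) km; have l_n := ne _ _ _ _ rkl rmn km.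
rewrite /= !inE !negb_or il jk jl ikn i_m i_n j_m j_n k_m k_n l_m l_n.
by rewrite eq_sym ji eq_sym lk eq_sym nm.
Qed.

End SixPoints.

(** * Collinearity and general position *)

Section Config.
Variable R : rcfType.
Local Notation K := (R[i]).
Implicit Types (p q w u v a b c : vec3 R) (F G : {mpoly K[3]}).

Lemma proportional_det3 a b c : proportional a b -> det3 a b c = 0.
Proof.
move=> h; rewrite det3E.
have -> : a i0 * (b i1 * c i2 - b i2 * c i1) - a i1 * (b i0 * c i2 - b i2 * c i0)
   + a i2 * (b i0 * c i1 - b i1 * c i0) = (a i0 * b i1 - a i1 * b i0) * c i2
   - (a i0 * b i2 - a i2 * b i0) * c i1 + (a i1 * b i2 - a i2 * b i1) * c i0 by ring.
by rewrite (h i0 i1) (h i0 i2) (h i1 i2); ring.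
Qed.

Lemma proportional_sym a b : proportional a b -> proportional b a.
Proof. by move=> h k l; rewrite mulrC -h mulrC. Qed.

Lemma det3_rot a b c : det3 a b c = det3 b c a.
Proof. by rewrite !det3E; ring. Qed.

Lemma det3_swap a b c : det3 a b c = - det3 a c b.
Proof. by rewrite !det3E; ring. Qed.

Lemma det3_eq0_swap a b c : det3 a b c = 0 -> det3 a c b = 0.
Proof. by move=> h; rewrite det3_swap h oppr0. Qed.

Lemma on_line p w u v : det3 p w u != 0 -> det3 p w v = 0 ->
  exists x y, v =1 comb3 x p y w 0 u.
Proof.
move=> D0; have [x [y [z e]]] := cramer v D0.
rewrite (eq_det3 _ _ e) det3_comb3 => /eqP; rewrite mulf_eq0 (negbTE D0) orbF => /eqP z0.
by exists x, y; move: e; rewrite z0.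
Qed.

Lemma collinear p w a b c : ~ proportional p w ->
  det3 p w a = 0 -> det3 p w b = 0 -> det3 p w c = 0 -> det3 a b c = 0.
Proof.
move=> /det3_extend[u D0] /(on_line D0)[x1 [y1 e1]] /(on_line D0)[x2 [y2 e2]].
move=> /(on_line D0)[x3 [y3 e3]].
by rewrite det3E !e1 !e2 !e3 /comb3; ring.
Qed.

Lemma mult_plane_ge1_eval F p : nonzero3 p -> mult_plane_ge F p 1 -> F.@[p] = 0.
Proof.
move=> /det3_basis[w [u D0]] /(_ w u D0) h.
have -> : F.@[p] = (F \mPo offchart p w u).@[fun=> 0].
  rewrite comp_mpoly_meval; apply: meval_eq => k; rewrite tnth_mktuple.
  by rewrite !mevalD !mevalM !mevalC !mevalXU !mulr0 !addr0.
rewrite mevalE big_seq big1 // => m /h; rewrite mdegE lt0n sum_nat_eq0 negb_forall.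
move=> /existsP[k]; rewrite implyTb => mk.
by rewrite (bigD1 k) //= expr0n (negbTE mk) mul0r mulr0.
Qed.

(** For a cubic, each restriction to a line through [p] vanishes at least doubly there, leaving a
    linear cofactor. A triple point on [E_i] forces this at [P i], while a triple point off the
    [P i] excludes it, so it separates the two kinds of points. *)
Definition double_at F p := forall v, exists e f, forall x y : K,
  F.@[fun k => x * p k + y * v k] = y ^+ 2 * (e * x + f * y).

Variable P : 'I_6 -> vec3 R.
Hypothesis P_collinear : forall i j k, uniq [:: i; j; k] -> det3 (P i) (P j) (P k) != 0.
Hypothesis P_conic : ~ (exists G : {mpoly K[3]},
  [/\ G != 0, G \is 2.-homog & forall k, G.@[P k] = 0]).

Lemma P_noncollinear p w :
  ~ proportional p w -> exists k, det3 p w (P k) != 0.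
Proof.
move=> np; have /existsP[k hk] : [exists k, det3 p w (P k) != 0]; last by exists k.
apply: contraT; rewrite negb_exists => /forallP h.
pose o k (hk : (k < 6)%N) : 'I_6 := Ordinal hk.
have : det3 (P (@o 0 isT)) (P (@o 1 isT)) (P (@o 2 isT)) != 0 by apply: P_collinear.
by rewrite (collinear np) ?eqxx //; apply/eqP; rewrite -[_ == _]negbK.
Qed.

Lemma P_nonproportional i j : i != j -> ~ proportional (P i) (P j).
Proof.
move=> ij pij.
have [k] : exists k, k \notin [:: i; j] by apply: ex_notin_seq.
rewrite !inE negb_or => /andP[ki kj].
have : det3 (P i) (P j) (P k) != 0.
  by apply: P_collinear; rewrite /= !inE negb_or ij eq_sym ki eq_sym kj.
by rewrite proportional_det3 ?eqxx.
Qed.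

Variable F : {mpoly K[3]}.
Hypothesis F_neq0 : F != 0.
Hypothesis F_homog : F \is 3.-homog.
Hypothesis F_P : forall i, F.@[P i] = 0.

(** * Cubics with a triple point off the six points *)

Section TriplePoint.
Variable q : vec3 R.
Hypothesis qP : forall i, ~ proportional q (P i).
Hypothesis Fq : mult_plane_ge F q 3.

(** [P a] and [P b] have [(y, z)] equal to [(1, 0)] and [(0, 1)], so vanishing there kills the
    coefficients of [y^3] and [z^3]. *)
Lemma triple_point_form (a b : 'I_6) : det3 q (P a) (P b) != 0 ->
  exists c2 c3 : K, (forall x y z, F.@[comb3 x q y (P a) z (P b)] = y * z * (c2 * y + c3 * z))
    /\ ~ (c2 = 0 /\ c3 = 0).
Proof.
move=> D0; have [c1 [c2 [c3 [c4 [E N]]]]] := offchart_cubic F_neq0 F_homog D0 (Fq D0).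
have h1 : c1 = 0.
  rewrite -(F_P a) (@meval_eq _ _ _ (comb3 0 q 1 (P a) 0 (P b))) ?E; first by ring.
  by move=> k; rewrite /comb3; ring.
have h4 : c4 = 0.
  rewrite -(F_P b) (@meval_eq _ _ _ (comb3 0 q 0 (P a) 1 (P b))) ?E; first by ring.
  by move=> k; rewrite /comb3; ring.
exists c2, c3; split=> [x y z|[h2 h3]]; last by apply: N.
by rewrite E h1 h4; ring.
Qed.

Lemma triple_point_root (a b c : 'I_6) (c2 c3 : K) : det3 q (P a) (P b) != 0 ->
  (forall x y z, F.@[comb3 x q y (P a) z (P b)] = y * z * (c2 * y + c3 * z)) ->
  det3 q (P a) (P c) != 0 -> det3 q (P b) (P c) != 0 ->
  exists x y z, [/\ P c =1 comb3 x q y (P a) z (P b), y != 0, z != 0 & c2 * y + c3 * z = 0].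
Proof.
move=> D0 E ac bc; have [x [y [z e]]] := cramer (P c) D0.
have z0 : z != 0.
  by move: ac; rewrite (eq_det3 _ _ e) det3_comb3 mulf_eq0 negb_or => /andP[].
have y0 : y != 0.
  apply: contraNneq bc => y0; rewrite (eq_det3 _ _ e) y0 det3E /comb3.
  by apply/eqP; ring.
exists x, y, z; split=> //.
have := F_P c; rewrite (meval_eq _ e) E => /eqP.
by rewrite !mulf_eq0 (negbTE y0) (negbTE z0) => /eqP.
Qed.

(** A nonzero binary cubic has at most three roots. The lines to [P a] and [P b] account for the
    factor [y z], and the remaining linear form would vanish at the two independent pairs given by
    [P c] and [P d]. *)
Lemma triple_point_four (a b c d : 'I_6) :
  det3 q (P a) (P b) != 0 -> det3 q (P a) (P c) != 0 -> det3 q (P a) (P d) != 0 ->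
  det3 q (P b) (P c) != 0 -> det3 q (P b) (P d) != 0 -> det3 q (P c) (P d) != 0 -> False.
Proof.
move=> ab ac ad bc bd cd; have [c2 [c3 [E N]]] := triple_point_form ab.
have [x [y [z [e y0 z0 h]]]] := triple_point_root ab E ac bc.
have [x' [y' [z' [e' y0' z0' h']]]] := triple_point_root ab E ad bd.
have W : y * z' - z * y' != 0.
  apply: contraNneq cd => W; have -> : det3 q (P c) (P d) =
      (y * z' - z * y') * det3 q (P a) (P b).
    by rewrite !det3E !e !e' /comb3; ring.
  by rewrite W mul0r.
apply: N; split; apply: (mulIf W); rewrite mul0r.
  have -> : c2 * (y * z' - z * y') = (c2 * y + c3 * z) * z' - (c2 * y' + c3 * z') * z by ring.
  by rewrite h h' !mul0r subr0.
have -> : c3 * (y * z' - z * y') = (c2 * y' + c3 * z') * y - (c2 * y + c3 * z) * y' by ring.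
by rewrite h h' !mul0r subr0.
Qed.

(** Lying on a common line through [q]. It is transitive because [q] differs from every [P i], and
    its classes are small because no three [P i] are collinear. *)
Let r := [rel i j | det3 q (P i) (P j) == 0].

Lemma on_common_line_sym x y : r x y = r y x.
Proof. by rewrite /= det3_swap oppr_eq0. Qed.

Lemma on_common_line_trans : transitive r.
Proof.
move=> b a c /= /eqP ab /eqP bc; apply/eqP.
apply: (collinear (qP (i := b))) => //; last exact: det3_eq0_swap.
by rewrite det3E; ring.
Qed.

Lemma on_common_line_card x y z : uniq [:: x; y; z] -> r x y -> r x z -> False.
Proof.
move=> /P_collinear /eqP h /= /eqP xy /eqP xz; apply: h.
by apply: (collinear (qP (i := x))) => //; rewrite det3E; ring.
Qed.

Lemma triple_point_lines : exists i j k l m n : 'I_6,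
  [/\ uniq [:: i; j; k; l; m; n], det3 (P i) (P j) q = 0,
      det3 (P k) (P l) q = 0 & det3 (P m) (P n) q = 0].
Proof.
have [i [j [k [l [m [n [u /eqP h1 /eqP h2 /eqP h3]]]]]]] :
    exists i j k l m n : 'I_6, [/\ uniq [:: i; j; k; l; m; n], r i j, r k l & r m n].
  apply: pairing6.
  - by move=> x /=; rewrite det3E; apply/eqP; ring.
  - exact: on_common_line_sym.
  - exact: on_common_line_trans.
  - exact: on_common_line_card.
  - exact: triple_point_four.
by exists i, j, k, l, m, n; rewrite -!(det3_rot q).
Qed.

(** In the basis [q], [q'], [P k] the triple point at [q] makes [F] independent of [x] and the one
    at [q'] makes it independent of [y]. Only [z^3] could remain, and vanishing at [P k] excludes
    it. *)
Lemma triple_point_unique q' : ~ proportional q q' -> mult_plane_ge F q' 3 -> False.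
Proof.
move=> np Fq'; have [k D0] := P_noncollinear np.
have D0' : det3 q' q (P k) != 0.
  have -> : det3 q' q (P k) = - det3 q q' (P k) by rewrite !det3E; ring.
  by rewrite oppr_eq0.
have [c1 [c2 [c3 [c4 [E N]]]]] := offchart_cubic F_neq0 F_homog D0 (Fq D0).
have [d1 [d2 [d3 [d4 [E' _]]]]] := offchart_cubic F_neq0 F_homog D0' (Fq' _ _ D0').
have EE x y z : c1 * y ^+ 3 + c2 * y ^+ 2 * z + c3 * y * z ^+ 2 + c4 * z ^+ 3
    = d1 * x ^+ 3 + d2 * x ^+ 2 * z + d3 * x * z ^+ 2 + d4 * z ^+ 3.
  by rewrite -(E x y z) -(E' y x z); apply: meval_eq => l; rewrite /comb3; ring.
have h4 : c4 = 0.
  rewrite -(F_P k) (@meval_eq _ _ _ (comb3 0 q 0 q' 1 (P k))) ?E; first by ring.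
  by move=> l; rewrite /comb3; ring.
have d40 : d4 = 0.
  transitivity (d1 * 0 ^+ 3 + d2 * 0 ^+ 2 * 1 + d3 * 0 * 1 ^+ 2 + d4 * 1 ^+ 3); first by ring.
  by rewrite -(EE 0 0 1) h4; ring.
have EY y z : c1 * y ^+ 3 + c2 * y ^+ 2 * z + c3 * y * z ^+ 2 = 0.
  transitivity (d1 * 0 ^+ 3 + d2 * 0 ^+ 2 * z + d3 * 0 * z ^+ 2 + d4 * z ^+ 3).
    by rewrite -(EE 0 y z) h4; ring.
  by rewrite d40; ring.
have h1 : c1 = 0 by rewrite -(EY 1 0); ring.
have s1 : c2 + c3 = 0 by rewrite -(EY 1 1) h1; ring.
have s2 : c2 - c3 = 0 by rewrite -(EY (-1) 1) h1; ring.
have h2 : c2 = 0.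
  have : c2 *+ 2 = 0 by rewrite mulr2n -[RHS](addr0 0) -{1}s1 -s2; ring.
  by move/eqP; rewrite mulrn_eq0 => /eqP.
by apply: N; split=> //; move: s1; rewrite h2 add0r.
Qed.

(** Choose [b] and [c] so that [P i], [P b], [P c] lie on three different lines through [q]. A
    double zero at [P i] on the line [P i P b] forces [c2 = 0], and then the root given by [P c]
    forces [c3 = 0]. *)
Lemma triple_point_not_double i : double_at F (P i) -> False.
Proof.
have C2 x := class_card2 x on_common_line_sym on_common_line_trans on_common_line_card.
move=> dbl.
have [b] : exists b : 'I_6, b \notin [set j | r i j].
  by apply: ex_notin; apply: leq_ltn_trans (C2 _) _.
rewrite inE /= => ib.
have [c] : exists c : 'I_6, c \notin [set j | r i j] :|: [set j | r b j].
  apply: ex_notin; apply: leq_ltn_trans (leq_card_setU _ _) _.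
  exact: leq_ltn_trans (leq_add (C2 _) (C2 _)) _.
rewrite !inE negb_or /= => /andP[ic bc].
have [c2 [c3 [E N]]] := triple_point_form ib.
have [x [y [z [e y0 z0 h]]]] := triple_point_root ib E ic bc.
have [d [f D]] := dbl (P b).
have DE s t : s * t * (c2 * s + c3 * t) = t ^+ 2 * (d * s + f * t).
  by rewrite -(E 0) -D; apply: meval_eq => k; rewrite /comb3; ring.
have f0 : f = 0.
  transitivity ((1 : K) ^+ 2 * (d * 0 + f * 1)); first by ring.
  by rewrite -DE; ring.
(* The values at [(1, 1)] and [(1, -1)] isolate [2 c2] on one side and [2 f] on the other. *)
have c20 : c2 = 0.
  have : c2 *+ 2 = 0.
    transitivity (1 * 1 * (c2 * 1 + c3 * 1) - (1 * (-1) * (c2 * 1 + c3 * (-1)))).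
      by ring.
    by rewrite !DE f0; ring.
  by move/eqP; rewrite mulrn_eq0 => /eqP.
apply: N; split=> //; move: h; rewrite c20 mul0r add0r => /eqP.
by rewrite mulf_eq0 (negbTE z0) orbF => /eqP.
Qed.

End TriplePoint.

(** * Cubics with a triple point on an exceptional curve *)

Section InfinitelyNear.
Variables (i : 'I_6) (w : vec3 R).
Hypothesis wP : ~ proportional w (P i).
Hypothesis Fw : forall u, det3 (P i) w u != 0 -> mono_ge (F \mPo excchart (P i) w u) 4.

(** The conic contains [P i] and every [P k] off the line [z = 0]. As no conic contains all six
    points, the line carries some [P j] besides [P i], and by general position no third point. *)
Lemma excchart_split : exists (j : 'I_6) u (c1 c2 c3 c4 : K),
  let G := tangent_conic (P i) w u c1 c2 c3 c4 in
  [/\ i != j, det3 (P i) w (P j) = 0, det3 (P i) w u != 0, c1 != 0 &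
   [/\ forall x y z, F.@[comb3 x (P i) y w z u] =
        z * (c1 * x * z + c2 * y ^+ 2 + c3 * y * z + c4 * z ^+ 2),
      G != 0, forall k, k != j -> G.@[P k] = 0 &
      forall k, k != i -> k != j -> det3 (P i) w (P k) != 0]].
Proof.
have np : ~ proportional (P i) w by move/proportional_sym.
have [u D0] := det3_extend np.
have [c1 [c2 [c3 [c4 [E N]]]]] := excchart_cubic F_neq0 F_homog D0 (Fw D0).
pose G := tangent_conic (P i) w u c1 c2 c3 c4.
have G0 : G != 0 by apply: tangent_conic_neq0.
have Gi : G.@[P i] = 0.
  rewrite (@meval_eq _ _ _ (comb3 1 (P i) 0 w 0 u)) ?tangent_conic_eval //; first by ring.
  by move=> k; rewrite /comb3; ring.
have Gk k : det3 (P i) w (P k) != 0 -> G.@[P k] = 0.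
  have [x [y [z e]]] := cramer (P k) D0.
  rewrite (eq_det3 _ _ e) det3_comb3 mulf_eq0 negb_or => /andP[z0 _].
  have := F_P k; rewrite !(meval_eq _ e) E => /eqP; rewrite mulf_eq0 (negbTE z0) => /eqP h.
  by rewrite tangent_conic_eval.
have [j ij wj] : exists2 j, i != j & det3 (P i) w (P j) = 0.
  have [/existsP[j /andP[h1 /eqP h2]]|] :=
    boolP [exists j, (i != j) && (det3 (P i) w (P j) == 0)]; first by exists j.
  rewrite negb_exists => /forallP h; case: P_conic; exists G; split=> //.
    exact: tangent_conic_homog.
  move=> k; have := h k; case: eqVneq => [<- //|ik] /=; exact: Gk.
have Dk k : k != i -> k != j -> det3 (P i) w (P k) != 0.
  move=> ki kj; apply/eqP => wk.
  have /eqP : det3 (P i) (P j) (P k) != 0.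
    by apply: P_collinear; rewrite /= !inE negb_or ij eq_sym ki eq_sym kj.
  by apply; apply: (collinear np) => //; rewrite det3E; ring.
exists j, u, c1, c2, c3, c4; split=> //; last first.
  split=> // k kj; case: (eqVneq k i) => [-> //|ki].
  by apply: Gk; apply: Dk.
(* If c1 = 0 the conic is a pair of lines through P i, yet it meets the three
   distinct lines joining P i to P a, P b and P c away from P i. *)
apply/eqP => c10.
have [a] : exists a : 'I_6, a \notin [:: i; j] by apply: ex_notin_seq.
rewrite !inE negb_or => /andP[ai aj].
have [b] : exists b : 'I_6, b \notin [:: i; j; a] by apply: ex_notin_seq.
rewrite !inE !negb_or => /and3P[bi bj ba].
have [c] : exists c : 'I_6, c \notin [:: i; j; a; b] by apply: ex_notin_seq.
rewrite !inE !negb_or => /and4P[ci cj ca cb].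
have root k : k != i -> k != j -> exists x y z, P k =1 comb3 x (P i) y w z u /\
    c2 * y ^+ 2 + c3 * y * z + c4 * z ^+ 2 = 0.
  move=> ki kj; have [x [y [z e]]] := cramer (P k) D0; exists x, y, z; split=> //.
  have := Gk _ (Dk _ ki kj); rewrite (meval_eq _ e) tangent_conic_eval // c10.
  by rewrite !mul0r add0r.
have [x1 [y1 [z1 [e1 r1]]]] := root a ai aj.
have [x2 [y2 [z2 [e2 r2]]]] := root b bi bj.
have [x3 [y3 [z3 [e3 r3]]]] := root c ci cj.
have W12 : y1 * z2 - z1 * y2 != 0.
  have : det3 (P i) (P a) (P b) != 0.
    by apply: P_collinear; rewrite /= !inE negb_or eq_sym ai eq_sym bi eq_sym ba.
  apply: contraNneq => W; have -> : det3 (P i) (P a) (P b) =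
      (y1 * z2 - z1 * y2) * det3 (P i) w u by rewrite !det3E !e1 !e2 /comb3; ring.
  by rewrite W mul0r.
have W13 : y1 * z3 - z1 * y3 != 0.
  have : det3 (P i) (P a) (P c) != 0.
    by apply: P_collinear; rewrite /= !inE negb_or eq_sym ai eq_sym ci eq_sym ca.
  apply: contraNneq => W; have -> : det3 (P i) (P a) (P c) =
      (y1 * z3 - z1 * y3) * det3 (P i) w u by rewrite !det3E !e1 !e3 /comb3; ring.
  by rewrite W mul0r.
have W23 : y2 * z3 - z2 * y3 != 0.
  have : det3 (P i) (P b) (P c) != 0.
    by apply: P_collinear; rewrite /= !inE negb_or eq_sym bi eq_sym ci eq_sym cb.
  apply: contraNneq => W; have -> : det3 (P i) (P b) (P c) =
      (y2 * z3 - z2 * y3) * det3 (P i) w u by rewrite !det3E !e2 !e3 /comb3; ring.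
  by rewrite W mul0r.
have W : (y1 * z2 - z1 * y2) * (y1 * z3 - z1 * y3) * (y2 * z3 - z2 * y3) != 0.
  by rewrite !mulf_neq0.
(* Cramer's rule for the Vandermonde system Q (yk, zk) = 0. *)
pose Q y z := c2 * y ^+ 2 + c3 * y * z + c4 * z ^+ 2.
apply: N; split=> //; apply: (mulIf W); rewrite mul0r.
- transitivity (Q y1 z1 * (z2 * z3 * (y2 * z3 - z2 * y3))
    - Q y2 z2 * (z1 * z3 * (y1 * z3 - z1 * y3)) + Q y3 z3 * (z1 * z2 * (y1 * z2 - z1 * y2))).
    by rewrite /Q; ring.
  by rewrite /Q r1 r2 r3; ring.
- transitivity (- Q y1 z1 * ((y2 * z3 + z2 * y3) * (y2 * z3 - z2 * y3))
    + Q y2 z2 * ((y1 * z3 + z1 * y3) * (y1 * z3 - z1 * y3))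
    - Q y3 z3 * ((y1 * z2 + z1 * y2) * (y1 * z2 - z1 * y2))).
    by rewrite /Q; ring.
  by rewrite /Q r1 r2 r3; ring.
- transitivity (Q y1 z1 * (y2 * y3 * (y2 * z3 - z2 * y3))
    - Q y2 z2 * (y1 * y3 * (y1 * z3 - z1 * y3)) + Q y3 z3 * (y1 * y2 * (y1 * z2 - z1 * y2))).
    by rewrite /Q; ring.
  by rewrite /Q r1 r2 r3; ring.
Qed.

(** On a line through [P i], the factor [z] and the conic each contribute a zero at [P i]. *)
Lemma excchart_double : double_at F (P i).
Proof.
have [j [u [c1 [c2 [c3 [c4 [ij wj D0 c10 [E _ _ _]]]]]]]] := excchart_split => v.
have [x [y [z e]]] := cramer v D0.
exists (c1 * z ^+ 2), (z * (c1 * x * z + c2 * y ^+ 2 + c3 * y * z + c4 * z ^+ 2)) => s t.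
rewrite (@meval_eq _ _ _ (comb3 (s + t * x) (P i) (t * y) w (t * z) u)).
  by rewrite E; ring.
by move=> k; rewrite e /comb3; ring.
Qed.

Lemma excchart_tangent : exists j, [/\ i != j, det3 (P i) w (P j) = 0 &
  exists G, [/\ conic_thru P j G, on_proper P G (Exc i w) & tangent_at G (P i) (P j)]].
Proof.
have [j [u [c1 [c2 [c3 [c4 [ij wj D0 c10 [E G0 GP _]]]]]]]] := excchart_split.
exists j; split=> //; exists (tangent_conic (P i) w u c1 c2 c3 c4); split.
- by split=> //; apply: tangent_conic_homog.
- exists 1%N; have T u' := tangent_conic_on_proper c2 c3 c4 D0 u' c10.
  have [h1 h2 _] := T u; split; [exact: h1 | exact: h2 |].
  by move=> u' _; have [_ _ h3] := T u'; exact: h3.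
- have [x [y e]] := on_line D0 wj; exact: tangent_conic_tangent e.
Qed.

End InfinitelyNear.

Lemma excchart_unique i w i' w' :
  ~ proportional w (P i) -> ~ proportional w' (P i') ->
  (forall u, det3 (P i) w u != 0 -> mono_ge (F \mPo excchart (P i) w u) 4) ->
  (forall u, det3 (P i') w' u != 0 -> mono_ge (F \mPo excchart (P i') w' u) 4) ->
  i' = i /\ det3 (P i') w' w = 0.
Proof.
move=> wP w'P Fw Fw'.
have [j [u [c1 [c2 [c3 [c4 [ij wj D0 c10 [E G0 GP Dk]]]]]]]] := excchart_split wP Fw.
have [j' [u' [d1 [d2 [d3 [d4 [ij' wj' D0' d10 [E' _ _ _]]]]]]]] := excchart_split w'P Fw'.
(* On the line through P i and P k, F vanishes exactly to order 2 at P i. *)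
have key k : k != i -> k != j -> exists e f, e != 0 /\ forall x y : K,
    F.@[fun l => x * P i l + y * P k l] = y ^+ 2 * (e * x + f * y).
  move=> ki kj; have [x [y [z e]]] := cramer (P k) D0.
  have z0 : z != 0.
    by have := Dk _ ki kj; rewrite (eq_det3 _ _ e) det3_comb3 mulf_eq0 negb_or => /andP[].
  exists (c1 * z ^+ 2), (z * (c1 * x * z + c2 * y ^+ 2 + c3 * y * z + c4 * z ^+ 2)).
  split=> [|s t]; first by rewrite mulf_neq0 // expf_neq0.
  rewrite (@meval_eq _ _ _ (comb3 (s + t * x) (P i) (t * y) w (t * z) u)).
    by rewrite E; ring.
  by move=> l; rewrite e /comb3; ring.
have two (e : K) : e *+ 2 = 0 -> e = 0 by move/eqP; rewrite mulrn_eq0 => /eqP.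
case: (eqVneq i' i) => [ei|i'i].
  (* Same index but different directions: [P j'] is not on the first line, yet [F] vanishes
     identically on the line [P i P j'], contradicting [key]. *)
  split=> //; move: D0' E' wj' ij'; rewrite {}ei => D0' E' wj' ij'.
  apply/eqP/negP => /negP D.
  have j'j : j' != j.
    apply/eqP => jj; rewrite jj in wj'.
    have [x [y e]] := on_line D wj'.
    have y0 : y = 0.
      move: wj; rewrite (eq_det3 _ _ e).
      have -> : det3 (P i) w (comb3 x (P i) y w' 0 w) = - y * det3 (P i) w' w.
        by rewrite !det3E /comb3; ring.
      by move/eqP; rewrite mulf_eq0 (negbTE D) orbF oppr_eq0 => /eqP.
    apply: (P_nonproportional ij) => k l; rewrite !e y0 /comb3; ring.
  have j'i : j' != i by rewrite eq_sym.
  have [e [f [e0 H]]] := key _ j'i j'j.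
  have [x [y ej]] := on_line D0' wj'.
  have Z s t : t ^+ 2 * (e * s + f * t) = 0.
    rewrite -H (@meval_eq _ _ _ (comb3 (s + t * x) (P i) (t * y) w' 0 u')).
      by rewrite E'; ring.
    by move=> l; rewrite ej /comb3; ring.
  case/eqP: e0; apply: two.
  transitivity (1 ^+ 2 * (e * 1 + f * 1) - 1 ^+ 2 * (e * (-1) + f * 1)); first by ring.
  by rewrite !Z subr0.
have dbl := excchart_double w'P Fw'; exfalso.
case: (eqVneq i' j) => [ej|i'j].
  (* The second centre is [P j]: a double zero of [F] there on the line to [u] puts [P j] on the
     conic as well, which then contains all six points. *)
  rewrite {}ej in dbl; have [e [f H]] := dbl u.
  have [x [y ej]] := on_line D0 wj.
  have Z s t : t * (c1 * s * x * t + c2 * (s * y) ^+ 2 + c3 * s * y * t + c4 * t ^+ 2)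
      = t ^+ 2 * (e * s + f * t).
    rewrite -H (@meval_eq _ _ _ (comb3 (s * x) (P i) (s * y) w t u)).
      by rewrite E; ring.
    by move=> l; rewrite ej /comb3; ring.
  have h : c2 * y ^+ 2 = 0.
    apply: two; pose g s t : K :=
      t * (c1 * s * x * t + c2 * (s * y) ^+ 2 + c3 * s * y * t + c4 * t ^+ 2).
    (* A second difference in [s] isolates [2 c2 y^2]; by [Z] the same function is affine in [s], so
       the difference vanishes. *)
    transitivity (g 1 1 + g (-1) 1 - g 0 1 *+ 2); first by rewrite /g; ring.
    by rewrite /g !Z; ring.
  apply: P_conic; exists (tangent_conic (P i) w u c1 c2 c3 c4); split=> //.
    exact: tangent_conic_homog.
  move=> k; case: (eqVneq k j) => [->|/GP //].
  by rewrite (meval_eq _ ej) tangent_conic_eval // h; ring.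
(* Any other index: the restriction of the cubic to the line [P i P i'] has double zeros at both
   points, hence vanishes, contradicting [key]. *)
have [e [f [e0 H]]] := key _ i'i i'j.
have [e' [f' H']] := dbl (P i).
have Z s t : t ^+ 2 * (e * s + f * t) = s ^+ 2 * (e' * t + f' * s).
  by rewrite -H -H'; apply: meval_eq => l; ring.
have f0 : f = 0.
  transitivity ((1 : K) ^+ 2 * (e * 0 + f * 1)); first by ring.
  by rewrite Z; ring.
have f0' : f' = 0.
  transitivity ((1 : K) ^+ 2 * (e' * 0 + f' * 1)); first by ring.
  by rewrite -Z; ring.
case/eqP: e0; apply: two.
transitivity (1 ^+ 2 * (e * 1 + f * 1) + (-1) ^+ 2 * (e * 1 + f * (-1))); first by ring.
by rewrite !Z f0'; ring.
Qed.

End Config.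

(** * Construction of the cubics *)

Section Divisors.
Variable R : rcfType.
Local Notation K := (R[i]).
Variable P : 'I_6 -> vec3 R.
Implicit Types (F G : {mpoly K[3]}).

(** A nonzero constant has order 0 in every chart, and a valid point has a chart. This is the lower
    bound [alpha >= 1]. *)
Lemma not_mult_div_ge_const F z m :
  valid_pt P z -> F != 0 -> F \is 0.-homog ->
  mult_div_ge P 0 F z m.+1 -> False.
Proof.
move=> vz F0 Fh.
have EF : F = (F@_0%MM)%:MP.
  rewrite [LHS](@msupp_sub_sum _ _ _ [:: 0%MM]) //.
    by rewrite big_seq1 mpolyX0 alg_mpolyC.
  by move=> n /(dhomog_mf Fh) /eqP; rewrite /= mdeg_eq0 inE.
have c0 : F@_0%MM != 0 by apply: contra F0 => /eqP h; rewrite EF h mpolyC0.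
have main n (T : 3.-tuple {mpoly K[n]}) k : mono_ge (F \mPo T) k.+1 -> False.
  rewrite EF comp_mpolyC => /(_ 0%MM); rewrite mcoeff_msupp mcoeffC eqxx mulr1 => /(_ c0).
  by rewrite mdeg0.
case: z vz => [q [q0 _]|i w [w0 wP]] h.
  by have [v1 [v2 /h /main]] := det3_basis q0.
have [u /h] : exists u, det3 (P i) w u != 0.
  by apply: det3_extend => /proportional_sym.
by rewrite addn0 => /main.
Qed.

Lemma line_poly_neq0 a b c : det3 a b c != 0 -> line_poly a b != 0 :> {mpoly K[3]}.
Proof. by apply: contraNneq => h; rewrite -line_poly_eval h meval0. Qed.

(** Passing through a point of [E_i] raises the order from the multiplicity [m] at [P i] to at least
    [m + 1]; when the curve contains [P i], this is at least 2. *)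
Lemma on_proper_excchart F i w : on_proper P F (Exc i w) ->
  exists m, (F.@[P i] = 0 -> (0 < m)%N) /\
    forall u, det3 (P i) w u != 0 -> mono_ge (F \mPo excchart (P i) w u) m.+1.
Proof.
case=> m [_ nm hm]; exists m; split; last exact: hm.
move=> /mult_plane_ge1 F1; case: m nm {hm} => [nm|m _]; last by [].
by case: nm.
Qed.

Lemma det3_proportional_eq0 a b (q q' : vec3 R) :
  nonzero3 q -> proportional q' q -> det3 a b q = 0 -> det3 a b q' = 0.
Proof.
move=> [j qj] pq D0; apply: (mulIf qj); rewrite mul0r.
transitivity (q' j * det3 a b q); last by rewrite D0 mulr0.
rewrite !det3E.
transitivity (a i0 * (b i1 * (q' i2 * q j) - b i2 * (q' i1 * q j)) -
  a i1 * (b i0 * (q' i2 * q j) - b i2 * (q' i0 * q j)) +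
  a i2 * (b i0 * (q' i1 * q j) - b i1 * (q' i0 * q j))); first by ring.
by rewrite !(pq _ j); ring.
Qed.

Lemma mult_div_ge_exc_transfer F i w z : F \is 3.-homog -> valid_pt P (Exc i w) ->
  (forall u, det3 (P i) w u != 0 -> mono_ge (F \mPo excchart (P i) w u) 4) ->
  same_pt P z (Exc i w) -> mult_div_ge P 1 F z 3.
Proof.
move=> F3 [w0 wP] h; case: z => [//|i' w'] /= [-> /det3_eq0_swap D] u' _.
have [u D0] : exists u, det3 (P i) w u != 0.
  by apply: det3_extend => /proportional_sym.
exact: (excchart_transfer F3 D0 D (h u D0)).
Qed.

Hypothesis P_collinear : forall i j k, uniq [:: i; j; k] -> det3 (P i) (P j) (P k) != 0.

Lemma uniq6_mem (s : seq 'I_6) : uniq s -> size s = 6 -> forall a, a \in s.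
Proof.
move=> us ss a; have sub : {subset s <= enum 'I_6} by move=> x _; rewrite mem_enum.
have := uniq_min_size us sub; rewrite size_enum_ord ss => /(_ isT) [_ ->].
by rewrite mem_enum.
Qed.

Lemma line_PP_neq0 i j : i != j -> line_poly (P i) (P j) != 0.
Proof.
move=> ij; have [u D0] := det3_extend (P_nonproportional P_collinear ij).
exact: line_poly_neq0 D0.
Qed.

Lemma line_PP_eval i j k : k \in [:: i; j] -> (line_poly (P i) (P j)).@[P k] = 0.
Proof.
rewrite line_poly_eval !inE => /orP[] /eqP ->; rewrite det3E; ring.
Qed.

Lemma line_offchart (a b q q' v1 v2 : vec3 R) : nonzero3 q -> proportional q' q ->
  (line_poly a b).@[q] = 0 -> det3 q' v1 v2 != 0 ->
  mono_ge (line_poly a b \mPo offchart q' v1 v2) 1.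
Proof.
rewrite line_poly_eval => q0 pq h D0; apply: mult_plane_ge1 D0.
by rewrite line_poly_eval; apply: det3_proportional_eq0 pq h.
Qed.

(** The product of the lines vanishes at all six points. Off the [P i] each line contributes order
    one at [Q]. On an exceptional curve each contributes [m + 1], and one of them passes through the
    centre, so the total is at least [2 + 1 + 1 = 4], as [m + d] requires. *)
Lemma three_lines_div n (Z : 'I_n -> spt R) Q (i j k l m n' : 'I_6) :
  valid_pt P Q -> (forall a, same_pt P (Z a) Q) -> uniq [:: i; j; k; l; m; n'] ->
  on_proper P (line_poly (P i) (P j)) Q -> on_proper P (line_poly (P k) (P l)) Q ->
  on_proper P (line_poly (P m) (P n')) Q -> has_div P Z 3 1.
Proof.
move=> vQ ZQ u6 h1 h2 h3.
set L1 := line_poly _ _ in h1; set L2 := line_poly _ _ in h2; set L3 := line_poly _ _ in h3.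
have cover a : [\/ L1.@[P a] = 0, L2.@[P a] = 0 | L3.@[P a] = 0].
  have := uniq6_mem u6 erefl a.
  rewrite (_ : [:: i; j; k; l; m; n'] = [:: i; j] ++ [:: k; l] ++ [:: m; n']) //.
  by rewrite !mem_cat => /or3P[] /line_PP_eval h; [apply: Or31|apply: Or32|apply: Or33].
have F3 : L1 * L2 * L3 \is 3.-homog.
  apply: (@dhomogM _ _ _ 2%N _ 1%N); last exact: line_poly_homog.
  by apply: (@dhomogM _ _ _ 1%N _ 1%N); exact: line_poly_homog.
exists (L1 * L2 * L3); split.
  split=> //.
    move: u6; rewrite /= !inE !negb_or -!andbA.
    case/and5P=> ij _ _ _ /and5P[_ _ _ _ /and5P[_ kl _ _ /and4P[_ _ mn _]]].
    by rewrite !mulf_neq0 // line_PP_neq0.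
  move=> a; apply: mult_plane_ge1; rewrite !mevalM.
  suff z0 (x y z : K) : [\/ x = 0, y = 0 | z = 0] -> x * y * z = 0 by exact: z0 (cover a).
  by case=> ->; rewrite ?mul0r ?mulr0 ?mul0r.
move=> a; have := ZQ a; case: Q vQ h1 h2 h3 {ZQ} => [q|b w] vQ.
  case: vQ => q0 _; case: (Z a) => [q'|b w] h1 h2 h3 pq; last by case: pq.
  move=> v1 v2 D0; rewrite !rmorphM.
  exact: (mono_geM (mono_geM (line_offchart q0 pq h1 D0) (line_offchart q0 pq h2 D0))
    (line_offchart q0 pq h3 D0)).
move=> /on_proper_excchart[m1 [p1 h1]] /on_proper_excchart[m2 [p2 h2]].
move=> /on_proper_excchart[m3 [p3 h3]].
move=> Zb; apply: (mult_div_ge_exc_transfer F3 vQ _ Zb) => u D0; rewrite !rmorphM.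
suff le4 : (4 <= m1.+1 + m2.+1 + m3.+1)%N.
  exact: (mono_ge_leq le4 (mono_geM (mono_geM (h1 u D0) (h2 u D0)) (h3 u D0))).
by case: (cover b) => [/p1|/p2|/p3]; lia.
Qed.

(** The line covers [P j] and the conic the other five points. Both pass through [P i], so each has
    order at least 2 in the exceptional chart, and [2 + 2 = 4] is the required [m + d]. *)
Lemma line_conic_div n (Z : 'I_n -> spt R) Q (i j : 'I_6) G :
  valid_pt P Q -> (forall a, same_pt P (Z a) Q) -> i != j -> on_E Q i ->
  on_proper P (line_poly (P i) (P j)) Q -> conic_thru P j G -> on_proper P G Q ->
  has_div P Z 3 1.
Proof.
move=> vQ ZQ ij QE h1 [G0 G2 GP] h2; set L := line_poly _ _ in h1.
have F3 : L * G \is 3.-homog.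
  by apply: (@dhomogM _ _ _ 1%N _ 2%N) => //; exact: line_poly_homog.
have Lj : L.@[P j] = 0 by apply: line_PP_eval; rewrite !inE eqxx orbT.
have Li : L.@[P i] = 0 by apply: line_PP_eval; rewrite !inE eqxx.
exists (L * G); split.
  split=> //; first by rewrite mulf_neq0 // line_PP_neq0.
  move=> a; apply: mult_plane_ge1; rewrite mevalM.
  apply/eqP; rewrite mulf_eq0.
  by case: (eqVneq a j) => [->|/GP h]; rewrite ?Lj ?h eqxx ?orbT.
move=> a; have := ZQ a; case: Q vQ h1 h2 QE {ZQ} => [//|b w vQ] h1 h2 /= bi.
rewrite {}bi in vQ h1 h2 *.
have [m1 [p1 {}h1]] := on_proper_excchart h1.
have [m2 [p2 {}h2]] := on_proper_excchart h2.
move=> Zi; apply: (mult_div_ge_exc_transfer F3 vQ _ Zi) => u D0; rewrite rmorphM.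
suff le4 : (4 <= m1.+1 + m2.+1)%N.
  exact: (mono_ge_leq le4 (mono_geM (h1 u D0) (h2 u D0))).
by have := p1 Li; have := p2 (GP _ ij); lia.
Qed.

End Divisors.

Theorem theorem11 (R : realType) (P : 'I_6 -> vec3 R) :
  general_six P ->
  forall (n : nat) (Z : 'I_n -> spt R),
    (0 < n)%N -> (forall k, valid_pt P (Z k)) ->
    ([/\ alpha_is P Z 1 1, alpha_is P Z 2 1 & alpha_is P Z 3 1] <->
     exists Q : spt R,
       [/\ valid_pt P Q, forall k, same_pt P (Z k) Q &
         (exists i j k l m n' : 'I_6,
            [/\ uniq [:: i; j; k; l; m; n'],
                on_proper P (line_poly (P i) (P j)) Q,
                on_proper P (line_poly (P k) (P l)) Q &
                on_proper P (line_poly (P m) (P n')) Q])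
         \/
         (exists i j : 'I_6,
            [/\ i != j, on_E Q i, on_proper P (line_poly (P i) (P j)) Q &
                exists G, [/\ conic_thru P j G, on_proper P G Q &
                              tangent_at G (P i) (P j)]])]).
Proof.
move=> [P0 Pcol Pcon] n Z n0 vZ; pose k0 : 'I_n := Ordinal n0; split; last first.
  case=> Q [vQ ZQ caseQ].
  have Z3 : has_div P Z 3 1.
    case: caseQ => [[i [j [k [l [m [n' [u6 h1 h2 h3]]]]]]]|[i [j [ij QE hL [G [GP hG _]]]]]].
      exact: three_lines_div vQ ZQ u6 h1 h2 h3.
    exact: line_conic_div vQ ZQ ij QE hL GP hG.
  (* One divisor of multiplicity 3 serves for the multiplicities 1 and 2 too; degree 0 is excluded
     at the point [Z k0], available since [Z] is nonempty. *)
  have alpha m : (m < 3)%N -> alpha_is P Z m.+1 1.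
    move=> m3; split.
      case: Z3 => F [Fl Fm]; exists F; split; first exact: Fl.
      move=> k; have := Fm k; case: (Z k) => [q|i w] h.
        by move=> v1 v2 D0; apply: mono_ge_leq (h v1 v2 D0).
      by move=> u D0; apply: mono_ge_leq (h u D0); rewrite leq_add2r.
    case=> [_|//] [F [[F0 Fh _] /(_ k0) h]].
    exact: not_mult_div_ge_const (vZ k0) F0 Fh h.
  by split; apply: alpha.
case=> _ _ [[F [[F0 F3 F1] FZ]] _].
have FP i : F.@[P i] = 0 by apply: mult_plane_ge1_eval (P0 i) (F1 i).
exists (Z k0); split; first exact: vZ.
  move=> k; have vk := vZ k; have v0 := vZ k0; have Fk := FZ k; have F0' := FZ k0.
  (* [F] has a triple point at both [Z k] and [Z k0]. Points of different kinds are separated by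
     [double_at]; points of the same kind coincide by the uniqueness lemmas. *)
  case: (Z k) vk Fk => [q|i w]; case: (Z k0) v0 F0' => [q'|i' w'].
  - move=> [q0' qP'] Fq' [q0 qP] Fq /=.
    apply: proportional_sym.
    have [/forallP h|] := boolP [forall k, [forall l, q' k * q l == q' l * q k]].
      by move=> a b; apply/eqP; have /forallP := h a.
    rewrite negb_forall => /existsP[a]; rewrite negb_forall => /existsP[b] ab.
    exfalso; apply: (triple_point_unique Pcol F0 F3 FP Fq' _ Fq) => pr.
    by move: ab; rewrite pr eqxx.
  - move=> [w0' wP'] Fw' [q0 qP] Fq.
    exfalso; apply: (triple_point_not_double Pcol F0 F3 FP qP Fq (i := i')).
    exact: (excchart_double Pcol Pcon F0 F3 FP wP' Fw').
  - move=> [q0' qP'] Fq' [w0 wP] Fw.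
    exfalso; apply: (triple_point_not_double Pcol F0 F3 FP qP' Fq' (i := i)).
    exact: (excchart_double Pcol Pcon F0 F3 FP wP Fw).
  - move=> [w0' wP'] Fw' [w0 wP] Fw.
    exact: (excchart_unique Pcol Pcon F0 F3 FP wP' wP Fw' Fw).
have v0 := vZ k0; have F0' := FZ k0.
case: (Z k0) v0 F0' => [q [q0 qP] Fq|i w [w0 wP] Fw].
  left; have [i [j [k [l [m [n' [u6 h1 h2 h3]]]]]]] := triple_point_lines Pcol F0 F3 FP qP Fq.
  by exists i, j, k, l, m, n'; split=> //=; rewrite line_poly_eval.
right; have [j [ij wj HG]] := excchart_tangent Pcol Pcon F0 F3 FP wP Fw.
exists i, j; split; [exact: ij | by [] | | exact: HG].
have D := det3_eq0_swap wj.
(* The line has multiplicity one at [P i], and [w] points along it because [P i], [w], [P j] are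
   collinear. *)
exists 1%N; have T u := line_poly_on_proper u D (P_nonproportional Pcol ij).
have [h1 h2 _] := T w; split; [exact: h1 | exact: h2 |].
by move=> u _; have [_ _ h3] := T u; exact: h3.
Qed.
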